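(* Let $M \in \mathcal{M}_{3,2}^{p \times q}$ and let $A^{(1)},\dots,A^{(p)},B^{(1)},\dots,B^{(q)}\in\mathcal{S}_+^2$ be a size-$2$ psd factorization of $M$. Let $A^{(1)},\dots,A^{(\bar p)},B^{(1)},\dots,B^{(\bar q)}$, $\bar p,\bar q\ge1$, be the collection of the factors that have rank one, written as $A^{(i)}=a_ia_i^T$, $B^{(j)}=b_jb_j^T$ with $a_i,b_j\in\mathbb{R}^2$. Assume that $\langle a_{i_1},b_{j_1}\rangle=0$ for some $(i_1,j_1)\in\{1,\dots,\bar p\}\times\{1,\dots,\bar q\}$, that $\det(a_i,a_j)\ne0$ and $\det(b_i,b_j)\neq0$ for all $i\neq j$, and that $\langle a_i,b_j\rangle\neq0$ for all $(i,j)\in\{1,\dots,\bar p\}\times\{1,\dots,\bar q\}$ with $(i,j)\ne(i_1,j_1)$. Then the factorization is $2$-infinitesimally rigid if and only if there exist factors of rank one $A^{(i_2)},A^{(i_3)},B^{(j_2)},B^{(j_3)}$ (with $i_1,i_2,i_3$ pairwise distinct and $j_1,j_2,j_3$ pairwise distinct) such that, together with $A^{(i_1)},B^{(j_1)}$, $$-\frac{\det(b_{j_1},b_{j_3}) \det(b_{j_2},b_{j_3}) \langle a_{i_1},b_{j_3} \rangle \langle a_{i_3},b_{j_3} \rangle}{\det(a_{i_1},a_{i_2}) \det(a_{i_2},a_{i_3}) \langle a_{i_2},b_{j_1} \rangle \langle a_{i_2},b_{j_2} \rangle} >0,$$ $$\frac{\det(b_{j_1},b_{j_3}) \det(b_{j_2},b_{j_3})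 \langle a_{i_1},b_{j_3} \rangle \langle a_{i_2},b_{j_3} \rangle}{\det(a_{i_1},a_{i_3}) \det(a_{i_2},a_{i_3}) \langle a_{i_3},b_{j_1} \rangle \langle a_{i_3},b_{j_2} \rangle} >0,$$ $$-\frac{\det(b_{j_1},b_{j_3}) \langle a_{i_1},b_{j_3} \rangle\langle a_{i_2},b_{j_3} \rangle \langle a_{i_3},b_{j_3} \rangle}{\det(b_{j_1},b_{j_2}) \langle a_{i_1},b_{j_2} \rangle \langle a_{i_2},b_{j_2} \rangle \langle a_{i_3},b_{j_2} \rangle} >0.$$
   Context: $\mathcal{S}^2$ (resp. $\mathcal{S}^2_+$) is the set of real symmetric (resp. symmetric positive semidefinite, psd) $2\times2$ matrices; $\langle X,Y\rangle=\operatorname{trace}(XY)$ for symmetric matrices, $\langle a,b\rangle=a^Tb$ for vectors; $\det(a,b)$ is the determinant of the $2\times2$ matrix with columns $a,b$. A size-$k$ psd factorization of a nonnegative $p\times q$ matrix $M$ is a tuple $A^{(1)},\dots,A^{(p)},B^{(1)},\dots,B^{(q)}$ of $k\times k$ psd matrices with $M_{ij}=\langle A^{(i)},B^{(j)}\rangle$; the psd rank of $M$ is the smallest such $k$. $\mathcal{M}_{3,2}^{p\times q}$ is the set of nonnegative $p\times q$ matrices of rank $3$ and psd rank $2$. A $2$-infinitesimal motion of a size-$2$ psd factorization is a tuple $(\dot A^{(1)},\dots,\dot A^{(p)},\dot B^{(1)},\dots,\dot B^{(q)})$ of matrices in $\mathcal{S}^2$ such that (1) $\langle\dot A^{(i)},B^{(j)}\rangle+\langle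 A^{(i)},\dot B^{(j)}\rangle=0$ for all $i,j$; and (2) there is $\varepsilon>0$ such that $A^{(i)}+t\dot A^{(i)}$ and $B^{(j)}+t\dot B^{(j)}$ are psd for all $i,j$ and all $t\in[0,\varepsilon)$. Put $\operatorname{vec}(X)=(X_{11},X_{22},\sqrt2X_{12})$ (row vector). If $M\in\mathcal{M}_{3,2}^{p\times q}$, every $2$-infinitesimal motion is given by a unique $D\in\mathbb{R}^{3\times3}$ via $\operatorname{vec}(\dot A^{(i)})=\operatorname{vec}(A^{(i)})D$ and $\operatorname{vec}(\dot B^{(j)})^T=-D\operatorname{vec}(B^{(j)})^T$. The motion is $2$-trivial if the same $D$ gives, by these formulas, a $2$-infinitesimal motion of every size-$2$ psd factorization of every matrix in $\mathcal{M}_{3,2}^{p\times q}$. A size-$2$ psd factorization of $M$ is $2$-infinitesimally rigid if all its $2$-infinitesimal motions are $2$-trivial. *)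

(* Defs.v *)
From HB Require Import structures.
From mathcomp Require Import all_boot all_order all_algebra.
From mathcomp Require Import reals.

Set Implicit Arguments.
Unset Strict Implicit.
Unset Printing Implicit Defensive.

Import Order.TTheory GRing.Theory Num.Theory.
Local Open Scope ring_scope.

Definition dotv (R : realType) (n : nat) (a b : 'cV[R]_n) : R :=
  (a^T *m b) 0 0.

Definition dotmx (R : realType) (k : nat) (X Y : 'M[R]_k) : R :=
  \tr (X *m Y).

Definition det2 (R : realType) (a b : 'cV[R]_2) : R :=
  \det (row_mx a b : 'M[R]_2).

Definition sym (R : realType) (k : nat) (X : 'M[R]_k) : Prop := X^T = X.

Definition psd (R : realType) (k : nat) (X : 'M[R]_k) : Prop :=
  sym X /\ forall v : 'cV[R]_k, 0 <= dotv v (X *m v).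

Definition psd_factorization (R : realType) (p q k : nat) (M : 'M[R]_(p, q))
    (A : 'I_p -> 'M[R]_k) (B : 'I_q -> 'M[R]_k) : Prop :=
  [/\ forall i, psd (A i),
      forall j, psd (B j)
    & forall i j, M i j = dotmx (A i) (B j)].

Definition has_psd_factorization (R : realType) (p q : nat) (M : 'M[R]_(p, q))
    (k : nat) : Prop :=
  exists (A : 'I_p -> 'M[R]_k) (B : 'I_q -> 'M[R]_k), psd_factorization M A B.

Definition is_psd_rank (R : realType) (p q : nat) (M : 'M[R]_(p, q))
    (k : nat) : Prop :=
  has_psd_factorization M k /\
  forall l : nat, has_psd_factorization M l -> (k <= l)%N.

Definition in_M32 (R : realType) (p q : nat) (M : 'M[R]_(p, q)) : Prop :=
  [/\ forall i j, 0 <= M i j, \rank M = 3%N & is_psd_rank M 2].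

Definition inf_motion2 (R : realType) (p q : nat)
    (A : 'I_p -> 'M[R]_2) (B : 'I_q -> 'M[R]_2)
    (dA : 'I_p -> 'M[R]_2) (dB : 'I_q -> 'M[R]_2) : Prop :=
  [/\ forall i, sym (dA i),
      forall j, sym (dB j),
      forall i j, dotmx (dA i) (B j) + dotmx (A i) (dB j) = 0
    & exists2 e : R, 0 < e &
        forall t : R, 0 <= t -> t < e ->
          (forall i, psd (A i + t *: dA i)) /\
          (forall j, psd (B j + t *: dB j))].

(* The factor sqrt 2 makes [svec] an isometry on symmetric matrices:
   [dotmx X Y] is the standard inner product of [svec X] and [svec Y]. *)
Definition svec (R : realType) (X : 'M[R]_2) : 'rV[R]_3 :=
  \row_j [:: X 0 0; X 1 1; Num.sqrt 2 * X 0 1]`_j.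

(* [svec] is bijective from symmetric matrices onto row vectors, so [D]
   determines the tuples of symmetric matrices [dA] and [dB]. *)
Definition motion_given_by (R : realType) (p q : nat) (D : 'M[R]_3)
    (A : 'I_p -> 'M[R]_2) (B : 'I_q -> 'M[R]_2)
    (dA : 'I_p -> 'M[R]_2) (dB : 'I_q -> 'M[R]_2) : Prop :=
  [/\ forall i, sym (dA i),
      forall j, sym (dB j),
      forall i, svec (dA i) = svec (A i) *m D
    & forall j, (svec (dB j))^T = - (D *m (svec (B j))^T)].

(* When [A], [B] factor a matrix of rank 3, the vectors [svec (A i)] span the
   whole space, hence the [D] giving the motion is unique. *)
Definition trivial2 (R : realType) (p q : nat)
    (A : 'I_p -> 'M[R]_2) (B : 'I_q -> 'M[R]_2)
    (dA : 'I_p -> 'M[R]_2) (dB : 'I_q -> 'M[R]_2) : Prop :=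
  exists2 D : 'M[R]_3, motion_given_by D A B dA dB &
    forall (M' : 'M[R]_(p, q)) (A' : 'I_p -> 'M[R]_2) (B' : 'I_q -> 'M[R]_2),
      in_M32 M' -> psd_factorization M' A' B' ->
      exists (dA' : 'I_p -> 'M[R]_2) (dB' : 'I_q -> 'M[R]_2),
        motion_given_by D A' B' dA' dB' /\ inf_motion2 A' B' dA' dB'.

Definition inf_rigid2 (R : realType) (p q : nat)
    (A : 'I_p -> 'M[R]_2) (B : 'I_q -> 'M[R]_2) : Prop :=
  forall (dA : 'I_p -> 'M[R]_2) (dB : 'I_q -> 'M[R]_2),
    inf_motion2 A B dA dB -> trivial2 A B dA dB.

(* Main.v *)
Require Import Defs.
From HB Require Import structures.
From mathcomp Require Import all_boot all_order all_algebra.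
From mathcomp Require Import boolp reals.
From mathcomp Require Import ring lra.

Set Implicit Arguments.
Unset Strict Implicit.
Unset Printing Implicit Defensive.

Import Order.TTheory GRing.Theory Num.Theory.
Local Open Scope ring_scope.

(** A motion of a factorization of a rank 3 matrix is a 3 x 3 matrix [D], read
as a linear map [L] on symmetric 2 x 2 matrices that moves the factors [X] of
the first family by [L X] and those of the second family by minus the adjoint
of [L]. Invertible factors impose no condition on [D]. A rank one factor
[a a^T] can move by [L (a a^T)] exactly when the quartic form
[F a = <L (a a^T), (J a)(J a)^T>], [J] the quarter turn, is positive, or zero
with [a a^T] an eigenvector of [L]; for [b b^T] the condition is [F (J b) <= 0],
with the same proviso for the adjoint. So [F] has to be nonnegative at the
[a_i] and nonpositive at the [J b_j], points of a projective line.

The point [a_i1 = J b_j1] belongs to both families: there [F] vanishes and both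
eigenvector conditions hold. In the orthonormal frame [e, J e] with [e] along
[a_i1] this makes [F (s e + J e)] a polynomial [f] of degree at most 2 in the
slope [s] ([quartic_slope]), an arbitrary one, to be nonnegative at the slopes
[s_i] of the [a_i] and nonpositive at the slopes [r_j] of the [J b_j].

Scalar [D] are trivial. On the other hand, rotating the factorization carries
[a_i1], hence the common point, to any point of the projective line, so [F]
vanishes identically for a trivial [D] ([trivial_quartic_eq0]): a motion whose
[f] is not zero is not trivial. Rigidity is thus decided by how the two
families of slopes interlace. If [s_2, s_3] separate [r_2, r_3], the Lagrange identity for four
points kills [f] ([crossing_quad_eq0]); then every [a_i a_i^T] is an
eigenvector, and two slopes besides [e] make [D] scalar
([scalar_of_two_slopes]). If no such quadruple exists, one family of slopes lies
in an interval free of the other, and some quadratic is strictly positive on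
the [s_i] and strictly negative on the [r_j] ([quad_separation]); it gives a non
trivial motion.

Finally the three inequalities of the theorem are the interlacing condition.
With [P = (s_2 - r_2)(s_3 - r_3)], [Q = (s_2 - r_3)(s_3 - r_2)] and
[W = (s_2 - s_3)(r_2 - r_3)] they say [W P > 0], [W Q < 0] and [P Q < 0]; since
[W = P - Q], the third one implies the others ([sign_conditions]). *)

(** * Coordinates of vectors and symmetric matrices in dimension 2 *)

Lemma sum_ord2 (V : nmodType) (F : 'I_2 -> V) : \sum_i F i = F 0 + F 1.
Proof.
rewrite big_ord_recl big_ord_recl big_ord0 addr0.
by congr (_ + F _); apply: val_inj.
Qed.

Lemma sum_ord3 (V : nmodType) (F : 'I_3 -> V) :
  \sum_i F i = F 0 + F 1 + F 2.
Proof.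
rewrite big_ord_recl big_ord_recl big_ord_recl big_ord0 addr0 addrA.
by congr (_ + F _ + F _); apply: val_inj.
Qed.

Lemma ord2P (P : 'I_2 -> Prop) : P 0 -> P 1 -> forall i, P i.
Proof.
move=> P0 P1 [[|[|//]] lt_i2]; first by rewrite (_ : Ordinal _ = 0) //; apply: val_inj.
by rewrite (_ : Ordinal _ = 1) //; apply: val_inj.
Qed.

Lemma ord3P (P : 'I_3 -> Prop) : P 0 -> P 1 -> P 2 -> forall i, P i.
Proof.
move=> P0 P1 P2 [[|[|[|//]]] lt_i3].
- by rewrite (_ : Ordinal _ = 0) //; apply: val_inj.
- by rewrite (_ : Ordinal _ = 1) //; apply: val_inj.
- by rewrite (_ : Ordinal _ = 2) //; apply: val_inj.
Qed.

Section Plane.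
Variable R : realType.
Implicit Types (u v w : 'cV[R]_2) (X Y : 'M[R]_2) (D : 'M[R]_3).

Lemma sum_sqr_le0 (x y : R) : x ^+ 2 + y ^+ 2 <= 0 -> x = 0 /\ y = 0.
Proof.
move=> le0; have := sqr_ge0 x; have := sqr_ge0 y => y2 x2.
by split; apply/eqP; rewrite -sqrf_eq0; apply/eqP; lra.
Qed.

(** The quarter turn [J]. *)
Definition perp v : 'cV[R]_2 := \col_i (if i == 0 then - v 1 0 else v 0 0).

Lemma perp0 v : perp v 0 0 = - v 1 0. Proof. by rewrite mxE. Qed.
Lemma perp1 v : perp v 1 0 = v 0 0. Proof. by rewrite mxE. Qed.

Lemma dotvE u v : dotv u v = u 0 0 * v 0 0 + u 1 0 * v 1 0.
Proof. by rewrite /dotv mxE sum_ord2 !mxE. Qed.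

Lemma det22E X : \det X = X 0 0 * X 1 1 - X 0 1 * X 1 0.
Proof.
rewrite (expand_det_row _ 0) sum_ord2 /cofactor !det_mx11 !mxE /= expr0 expr1.
have -> : lift (0 : 'I_2) (0 : 'I_1) = 1 by apply: val_inj.
have -> : lift (1 : 'I_2) (0 : 'I_1) = 0 by apply: val_inj.
ring.
Qed.

Lemma det2E u v : det2 u v = u 0 0 * v 1 0 - u 1 0 * v 0 0.
Proof.
have c0 i : (row_mx u v : 'M_2) i 0 = u i 0.
  by rewrite -(row_mxEl u v i 0); congr (row_mx u v i _); apply: val_inj.
have c1 i : (row_mx u v : 'M_2) i 1 = v i 0.
  by rewrite -(row_mxEr u v i 0); congr (row_mx u v i _); apply: val_inj.
by rewrite /det2 det22E !c0 !c1; ring.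
Qed.

Lemma colP2 u v : u 0 0 = v 0 0 -> u 1 0 = v 1 0 -> u = v.
Proof. by move=> e0 e1; apply/colP => i; elim/ord2P: i. Qed.

Lemma sq_norm_gt0 v : v != 0 -> 0 < dotv v v.
Proof.
move=> v0; rewrite dotvE lt0r; apply/andP; split; last by nra.
apply: contra v0 => /eqP vv; apply/eqP; apply: colP2; rewrite mxE; nra.
Qed.

Lemma symE X : sym X <-> X 1 0 = X 0 1.
Proof.
split=> [sX|e]; first by rewrite -[in LHS]sX mxE.
by apply/matrixP => i j; elim/ord2P: i; elim/ord2P: j; rewrite mxE.
Qed.

Lemma matP2 X Y : sym X -> sym Y ->
  X 0 0 = Y 0 0 -> X 1 1 = Y 1 1 -> X 0 1 = Y 0 1 -> X = Y.
Proof.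
move=> /symE sX /symE sY e0 e1 e2.
by apply/matrixP => i j; elim/ord2P: i; elim/ord2P: j; rewrite ?sX ?sY.
Qed.

Lemma outerE v i j : (v *m v^T) i j = v i 0 * v j 0.
Proof. by rewrite mxE big_ord1 mxE. Qed.

Lemma sym_outer v : sym (v *m v^T).
Proof. by rewrite /sym trmx_mul trmxK. Qed.

Lemma symD X Y (t : R) : sym X -> sym Y -> sym (X + t *: Y).
Proof. by rewrite /sym => sX sY; rewrite linearD linearZ /= sX sY. Qed.

Lemma symZ X (t : R) : sym X -> sym (t *: X).
Proof. by rewrite /sym => sX; rewrite linearZ /= sX. Qed.

Lemma dotmx_sym X Y : sym X -> sym Y ->
  Defs.dotmx X Y = X 0 0 * Y 0 0 + X 1 1 * Y 1 1 + 2 * X 0 1 * Y 0 1.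
Proof.
move=> /symE sX /symE sY.
rewrite /Defs.dotmx /mxtrace sum_ord2 !mxE !sum_ord2 sX sY; ring.
Qed.

Lemma det_sym X : sym X -> \det X = X 0 0 * X 1 1 - X 0 1 ^+ 2.
Proof. by move=> /symE sX; rewrite det22E sX. Qed.

Lemma quad_formE X v : sym X ->
  dotv v (X *m v) = v 0 0 ^+ 2 * X 0 0 + v 1 0 ^+ 2 * X 1 1
                    + 2 * v 0 0 * v 1 0 * X 0 1.
Proof. by move=> /symE sX; rewrite dotvE !mxE !sum_ord2 sX; ring. Qed.

(** Reduces positivity to two scalar inequalities, polynomial along a line of
matrices. *)
Lemma psd_tr_det X : psd X <-> [/\ sym X, 0 <= \tr X & 0 <= \det X].
Proof.
rewrite /mxtrace sum_ord2; split=> [[sX pX]|[sX trX detX]].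
  have form x y : 0 <= x ^+ 2 * X 0 0 + y ^+ 2 * X 1 1 + 2 * x * y * X 0 1.
    have := pX (\col_i (if i == 0 then x else y)).
    by rewrite quad_formE // !mxE /=.
  have X00 : 0 <= X 0 0 by have := form 1 0; lra.
  have X11 : 0 <= X 1 1 by have := form 0 1; lra.
  split; rewrite ?det_sym //; first lra.
  have [tr_gt0|tr_le0] := ltP 0 (X 0 0 + X 1 1); last first.
    have z0 : X 0 0 = 0 by lra.
    have z1 : X 1 1 = 0 by lra.
    have -> : X 0 1 = 0 by have := form 1 1; have := form 1 (-1); lra.
    by rewrite z0 z1; lra.
  rewrite -(pmulr_rge0 _ tr_gt0).
  have := form (- X 0 1) (X 0 0); have := form (X 1 1) (- X 0 1); nra.
split=> // v; rewrite quad_formE //.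
rewrite det_sym // in detX.
set x := v 0 0; set y := v 1 0; move: trX detX.
move: (X 0 0) (X 1 1) (X 0 1) => p q r trX detX.
have [tr_gt0|tr_le0] := ltP 0 (p + q); last first.
  have qE : q = - p by lra.
  have [|p0 r0] := @sum_sqr_le0 p r; first by rewrite qE in detX; lra.
  by rewrite qE p0 r0; lra.
rewrite -(pmulr_rge0 _ tr_gt0).
have : 0 <= (p * x + r * y) ^+ 2 + (q * y + r * x) ^+ 2
            + (p * q - r ^+ 2) * (x ^+ 2 + y ^+ 2).
  apply: addr_ge0; first by rewrite addr_ge0 ?sqr_ge0.
  by apply: mulr_ge0 => //; rewrite addr_ge0 ?sqr_ge0.
by congr (_ <= _); ring.
Qed.

End Plane.

(** * First order motions inside the cone of psd matrices *)

Section Feasible.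
Variable R : realType.
Implicit Types (u v w : 'cV[R]_2) (X Y : 'M[R]_2) (D : 'M[R]_3).

(** The polar form of the determinant: the coefficient of [t] in
[det_line]. *)
Definition det_polar X Y : R := X 0 0 * Y 1 1 + X 1 1 * Y 0 0 - 2 * X 0 1 * Y 0 1.

Lemma det_line X Y t : sym X -> sym Y ->
  \det (X + t *: Y) = \det X + t * det_polar X Y + t ^+ 2 * \det Y.
Proof.
move=> sX sY; rewrite !det_sym //; last exact: symD.
by rewrite !mxE /det_polar; ring.
Qed.

(** The adjugate of [v v^T] is [(J v)(J v)^T]. *)
Lemma det_polar_outer v Y : sym Y ->
  det_polar (v *m v^T) Y = Defs.dotmx Y (perp v *m (perp v)^T).
Proof.
move=> sY; rewrite dotmx_sym //; last exact: sym_outer.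
by rewrite /det_polar !outerE !perp0 !perp1; ring.
Qed.

Lemma small_pos (a b c : R) : 0 < a \/ a = 0 /\ 0 < b ->
  exists2 e : R, 0 < e & forall t, 0 <= t -> t < e -> 0 <= a + t * b + t ^+ 2 * c.
Proof.
case=> [a_gt0|[-> b_gt0]].
  have d_gt0 : 0 < `|b| + `|c| + 1 by have := normr_ge0 b; have := normr_ge0 c; lra.
  exists (Num.min 1 (a / (`|b| + `|c| + 1))); first by rewrite lt_min ltr01 divr_gt0.
  move=> t t0; rewrite lt_min => /andP[t1]; rewrite ltr_pdivlMr // => ta.
  have b1 : - `|b| <= b by have := ler_norm (- b); rewrite normrN; lra.
  have c1 : - `|c| <= c by have := ler_norm (- c); rewrite normrN; lra.
  have := ler_wpM2l t0 b1.
  have := ler_wpM2l (sqr_ge0 t) c1.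
  have tt : t ^+ 2 <= t by nra.
  have := ler_wpM2r (normr_ge0 c) tt.
  by lra.
have d_gt0 : 0 < `|c| + 1 by have := normr_ge0 c; lra.
exists (b / (`|c| + 1)); first by rewrite divr_gt0.
move=> t t0; rewrite ltr_pdivlMr // => tb.
have c1 : - `|c| <= c by have := ler_norm (- c); rewrite normrN; lra.
have := ler_wpM2l t0 c1 => tc.
have -> : 0 + t * b + t ^+ 2 * c = t * (b + t * c) by ring.
by apply: mulr_ge0 => //; lra.
Qed.

(** Moving along [Y] from [X] keeps the trace positive for a short time, so only
the determinant matters: it stays nonnegative if it starts positive or has a
positive derivative. A multiple of [X] only rescales [X], whatever the rank. *)
Lemma feasible_of_conditions X Y : psd X -> sym Y -> (X = 0 -> Y = 0) ->
  [\/ 0 < \det X, 0 < det_polar X Y | exists c, Y = c *: X] ->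
  exists2 e : R, 0 < e & forall t, 0 <= t -> t < e -> psd (X + t *: Y).
Proof.
move=> pX sY X0; have [sX trX detX] := (psd_tr_det X).1 pX.
have [tr0|tr_neq0] := eqVneq (\tr X) 0.
  have XE : X = 0.
    move: tr0 detX; rewrite /mxtrace sum_ord2 det_sym // => tr0 detX.
    have X11 : X 1 1 = - X 0 0 by lra.
    have [|X00 X01] := @sum_sqr_le0 _ (X 0 0) (X 0 1).
      by rewrite X11 in detX; lra.
    by apply: matP2 => //; rewrite ?mxE ?X11 ?X00 ?X01 ?oppr0 // /sym trmx0.
  move=> _; exists 1 => // t _ _.
  by rewrite (X0 XE) scaler0 addr0.
have tr_gt0 : 0 < \tr X by rewrite lt0r tr_neq0.
have [e1 e1_gt0 tr_pos] := small_pos (b := \tr Y) 0 (or_introl tr_gt0).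
have trE t : \tr (X + t *: Y) = \tr X + t * \tr Y + t ^+ 2 * 0.
  by rewrite mxtraceD mxtraceZ mulr0 addr0.
have combine : 0 < \det X \/ \det X = 0 /\ 0 < det_polar X Y ->
    exists2 e : R, 0 < e & forall t, 0 <= t -> t < e -> psd (X + t *: Y).
  move=> /(small_pos (\det Y))[e2 e2_gt0 det_pos].
  exists (Num.min e1 e2); first by rewrite lt_min e1_gt0.
  move=> t t0; rewrite lt_min => /andP[te1 te2].
  apply/psd_tr_det; split; first exact: symD.
    by rewrite trE; apply: tr_pos.
  by rewrite det_line //; apply: det_pos.
case=> [d|d|[c YE]].
- by apply: combine; left.
- apply: combine; have [d0|d0] := ltP 0 (\det X); first by left.
  by right; split=> //; apply/eqP; rewrite eq_le d0.
have [e e_gt0 pos] := small_pos 0 (or_introl (ltr01 : 0 < 1 :> R)) (b := c).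
exists e => // t t0 te; apply/psd_tr_det; split; first exact: symD.
  rewrite mxtraceD YE !mxtraceZ mulrA -{1}[\tr X]mul1r -mulrDl.
  by apply: mulr_ge0 => //; have := pos t t0 te; rewrite mulr0 addr0.
rewrite YE scalerA -{1}[X]scale1r -scalerDl detZ.
by apply: mulr_ge0 => //; apply: sqr_ge0.
Qed.

(** At a rank one matrix the determinant starts at 0 with derivative the pairing
below, which must be nonnegative. When it vanishes, the second order term
[det Y] must be nonnegative; in the basis [v, J v] the matrix [Y] has a zero
diagonal entry, so this forces its off-diagonal entry to vanish. *)
Lemma rank1_feasible v Y (e : R) : v != 0 -> sym Y -> 0 < e ->
  (forall t, 0 <= t -> t < e -> psd (v *m v^T + t *: Y)) ->
  0 <= Defs.dotmx Y (perp v *m (perp v)^T) /\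
  (Defs.dotmx Y (perp v *m (perp v)^T) = 0 -> exists c, Y = c *: (v *m v^T)).
Proof.
move=> v0 sY e_gt0 feas.
have sv := sym_outer v.
set q := Defs.dotmx _ _.
have line t : 0 < t -> t < e -> 0 <= q + t * \det Y.
  move=> t0 te; have [_ _] := (psd_tr_det _).1 (feas t (ltW t0) te).
  rewrite det_line // det_polar_outer // -/q [\det (v *m _)]det_sym // !outerE.
  have -> : v 0 0 * v 0 0 * (v 1 0 * v 1 0) - (v 0 0 * v 1 0) ^+ 2 = 0 by ring.
  have -> : 0 + t * q + t ^+ 2 * \det Y = t * (q + t * \det Y) by ring.
  by rewrite pmulr_rge0.
split.
  rewrite leNgt; apply/negP => q_lt0.
  have q_gt0 : 0 < - q by lra.
  have d_gt0 : 0 < `|\det Y| + 1 by have := normr_ge0 (\det Y); lra.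
  have [t [t0 te tq]] : exists t, [/\ 0 < t, t < e & t * (`|\det Y| + 1) <= - q].
    exists (Num.min (e / 2) (- q / (`|\det Y| + 1))); split.
    - by rewrite lt_min !divr_gt0.
    - by rewrite gt_min; apply/orP; left; lra.
    - by rewrite -ler_pdivlMr // ge_min lexx orbT.
  have := line t t0 te; have := ler_wpM2l (ltW t0) (ler_norm (\det Y)).
  by lra.
move=> q0; have detY : 0 <= \det Y.
  have := line (e / 2); rewrite q0 add0r pmulr_rge0; last by lra.
  by apply; lra.
have n_gt0 := sq_norm_gt0 v0; move: q0 detY n_gt0.
rewrite /q dotmx_sym //; last exact: sym_outer.
rewrite det_sym // dotvE !outerE !perp0 !perp1.
set x := v 0 0; set y := v 1 0.
set r := _ + _ + _ => q0 detY n_gt0.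
set n := x * x + y * y in n_gt0 *.
have n0 : n != 0 by rewrite gt_eqF.
(* [m], [r] and [k] are the entries of [Y] in the basis [v, J v]: off the
   diagonal, and on it at [J v] and at [v]. *)
pose m := - x * y * Y 0 0 + (x ^+ 2 - y ^+ 2) * Y 0 1 + x * y * Y 1 1.
pose k := x ^+ 2 * Y 0 0 + 2 * x * y * Y 0 1 + y ^+ 2 * Y 1 1.
have m0 : m = 0.
  have : 0 <= n ^+ 2 * (Y 0 0 * Y 1 1 - Y 0 1 ^+ 2) by rewrite mulr_ge0 // sqr_ge0.
  have -> : n ^+ 2 * (Y 0 0 * Y 1 1 - Y 0 1 ^+ 2)
     = k * r - m ^+ 2.
    by rewrite /n /k /m /r; ring.
  by rewrite q0 => m2; apply/eqP; rewrite -sqrf_eq0 eq_le sqr_ge0 andbT; lra.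
exists (k / n ^+ 2); apply: matP2 => //; first exact: symZ.
- rewrite mxE outerE -?/x -?/y; apply: (mulfI (expf_neq0 2 n0)).
  have -> : n ^+ 2 * (k / n ^+ 2 * (x * x)) = k * (x * x) by field.
  have -> : n ^+ 2 * Y 0 0 = k * (x * x) + (- (2 * x * y)) * m + (y ^+ 2) * r.
    by rewrite /n /k /m /r; ring.
  by rewrite m0 q0; ring.
- rewrite mxE outerE -?/x -?/y; apply: (mulfI (expf_neq0 2 n0)).
  have -> : n ^+ 2 * (k / n ^+ 2 * (y * y)) = k * (y * y) by field.
  have -> : n ^+ 2 * Y 1 1 = k * (y * y) + (2 * x * y) * m + (x ^+ 2) * r.
    by rewrite /n /k /m /r; ring.
  by rewrite m0 q0; ring.
- rewrite mxE outerE -?/x -?/y; apply: (mulfI (expf_neq0 2 n0)).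
  have -> : n ^+ 2 * (k / n ^+ 2 * (x * y)) = k * (x * y) by field.
  have -> : n ^+ 2 * Y 0 1 = k * (x * y) + (x ^+ 2 - y ^+ 2) * m + (- (x * y)) * r.
    by rewrite /n /k /m /r; ring.
  by rewrite m0 q0; ring.
Qed.

End Feasible.

(** * Sign patterns of quadratic polynomials *)

Section Quadratics.
Variable R : realType.
Implicit Types (s t : R) (S T : seq R).

Lemma sqr_gt0 (x : R) : x != 0 -> 0 < x ^+ 2.
Proof. by move=> x0; rewrite lt0r expf_neq0 ?sqr_ge0. Qed.

Lemma pow4_gt0 (x : R) : x != 0 -> 0 < x ^+ 4.
Proof. by move=> x0; rewrite (exprM x 2 2) sqr_gt0 ?expf_neq0. Qed.

Definition quad (c0 c1 c2 t : R) : R := c0 + c1 * t + c2 * t ^+ 2.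

(** The product of the numerator and the denominator of a cross-ratio, hence
negative iff the pairs [s, s'] and [t, t'] interlace. *)
Definition crossing s s' t t' : R := (s - t) * (s' - t') * ((s - t') * (s' - t)).

Lemma quad_roots3 c0 c1 c2 s s' t : s != s' -> s != t -> s' != t ->
  quad c0 c1 c2 s = 0 -> quad c0 c1 c2 s' = 0 -> quad c0 c1 c2 t = 0 ->
  [/\ c0 = 0, c1 = 0 & c2 = 0].
Proof.
rewrite -subr_eq0 -[s == t]subr_eq0 -[s' == t]subr_eq0 /quad => ss st st' fs fs' ft.
have d1 : c1 + c2 * (s + s') = 0.
  apply: (mulfI ss); rewrite mulr0.
  have -> : (s - s') * (c1 + c2 * (s + s'))
     = (c0 + c1 * s + c2 * s ^+ 2) - (c0 + c1 * s' + c2 * s' ^+ 2) by ring.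
  by rewrite fs fs' subrr.
have d2 : c1 + c2 * (s + t) = 0.
  apply: (mulfI st); rewrite mulr0.
  have -> : (s - t) * (c1 + c2 * (s + t))
     = (c0 + c1 * s + c2 * s ^+ 2) - (c0 + c1 * t + c2 * t ^+ 2) by ring.
  by rewrite fs ft subrr.
have c20 : c2 = 0.
  apply: (mulfI st'); rewrite mulr0.
  have -> : (s' - t) * c2 = (c1 + c2 * (s + s')) - (c1 + c2 * (s + t)) by ring.
  by rewrite d1 d2 subrr.
rewrite c20 in d1 fs.
have c10 : c1 = 0 by lra.
by split=> //; rewrite c10 in fs; lra.
Qed.

(** The third divided difference of a quadratic at four points is zero. When the
points interlace its coefficients alternate in sign along the line, so the sign
conditions force every term, hence the polynomial, to vanish. *)
Lemma crossing_quad_eq0 c0 c1 c2 s s' t t' : crossing s s' t t' < 0 ->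
  0 <= quad c0 c1 c2 s -> 0 <= quad c0 c1 c2 s' ->
  quad c0 c1 c2 t <= 0 -> quad c0 c1 c2 t' <= 0 ->
  [/\ c0 = 0, c1 = 0 & c2 = 0].
Proof.
move=> cr fs fs' ft ft'.
have nz : [&& s - t != 0, s' - t' != 0, s - t' != 0 & s' - t != 0].
  have : crossing s s' t t' != 0 by rewrite lt_eqF.
  by rewrite /crossing !mulf_eq0 !negb_or -!andbA.
case/and4P: nz => st st' st'' st'''.
set P := (s - t) * (s' - t'); set Q := (s - t') * (s' - t).
have PQ : P * Q < 0 by [].
have W : P - Q = (s - s') * (t - t') by rewrite /P /Q; ring.
have W0 : P - Q != 0.
  apply: contraTneq PQ => /eqP; rewrite subr_eq0 => /eqP ->.
  by rewrite -leNgt -expr2 sqr_ge0.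
have [ss tt] : s - s' != 0 /\ t - t' != 0.
  by apply/andP; rewrite -negb_or -mulf_eq0 -W.
have WP : 0 < (P - Q) * P by have := sqr_ge0 P; lra.
have WQ : (P - Q) * Q < 0 by have := sqr_ge0 Q; lra.
(* The Lagrange coefficients, scaled by [(t - t')(s' - t)(s' - t')] times the
   product of all differences: this makes their signs visible. *)
pose k1 := ((t - t') * (s' - t) * (s' - t')) ^+ 2.
pose k2 := - ((t - t') ^+ 2 * (P * Q)).
pose k3 := - ((P - Q) * Q * (s' - t') ^+ 2).
pose k4 := (P - Q) * P * (s' - t) ^+ 2.
have k1_gt0 : 0 < k1 by apply: sqr_gt0; rewrite !mulf_neq0.
have k2_gt0 : 0 < k2 by rewrite oppr_gt0 pmulr_rlt0 // sqr_gt0.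
have k3_gt0 : 0 < k3 by rewrite oppr_gt0 pmulr_llt0 // sqr_gt0.
have k4_gt0 : 0 < k4 by rewrite pmulr_rgt0 // sqr_gt0.
have lagrange : k1 * quad c0 c1 c2 s + k2 * quad c0 c1 c2 s'
    = k3 * quad c0 c1 c2 t + k4 * quad c0 c1 c2 t'.
  by rewrite /k1 /k2 /k3 /k4 /quad /P /Q; ring.
have p1 := mulr_ge0 (ltW k1_gt0) fs.
have p2 := mulr_ge0 (ltW k2_gt0) fs'.
have p3 : k3 * quad c0 c1 c2 t <= 0 by rewrite pmulr_rle0.
have p4 : k4 * quad c0 c1 c2 t' <= 0 by rewrite pmulr_rle0.
have zero (k f : R) : 0 < k -> k * f = 0 -> f = 0.
  by move=> k0 /eqP; rewrite mulf_eq0 gt_eqF //= => /eqP.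
have f1 : quad c0 c1 c2 s = 0 by apply: (zero _ _ k1_gt0); lra.
have f2 : quad c0 c1 c2 s' = 0 by apply: (zero _ _ k2_gt0); lra.
have f3 : quad c0 c1 c2 t = 0 by apply: (zero _ _ k3_gt0); lra.
by apply: (quad_roots3 _ _ _ f1 f2 f3); rewrite -subr_eq0.
Qed.

Lemma seq_min (x : R) S : exists2 m, m \in x :: S & {in x :: S, forall s, m <= s}.
Proof.
elim: S x => [|y S IH] x.
  by exists x; rewrite ?mem_head // => s; rewrite inE => /eqP ->.
have [m mS mle] := IH y; have [xm|mx] := leP x m.
  exists x; rewrite ?mem_head // => s; rewrite inE => /orP[/eqP -> //|sS].
  exact: le_trans (mle s sS).
exists m; first by rewrite inE mS orbT.
by move=> s; rewrite inE => /orP[/eqP ->|sS]; [exact: ltW|exact: mle].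
Qed.

Lemma seq_max (x : R) S : exists2 m, m \in x :: S & {in x :: S, forall s, s <= m}.
Proof.
have [m] := seq_min (- x) (map -%R S); rewrite -map_cons.
case/mapP => s sS -> le; exists s => // t tS.
by rewrite -lerN2; apply/le/map_f.
Qed.

Lemma pos_lower_bound (I : eqType) (r : seq I) (f : I -> R) :
  {in r, forall i, 0 < f i} -> exists2 e : R, 0 < e & {in r, forall i, e <= f i}.
Proof.
move=> f_gt0; have [m] := seq_min 1 (map f r).
rewrite inE => mr le; exists m.
  by case/orP: mr => [/eqP ->//|/mapP[i ir ->]]; exact: f_gt0.
by move=> i ir; apply: le; rewrite inE map_f ?orbT.
Qed.

(** When no [t] lies between two of the [s], a downward parabola with roots just
outside the extreme values of [S] separates; it is written as
[d/2 - (x - m)(x - n)], with [m, n] these extreme values. *)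
Lemma quad_separation_block S T :
  {in S & S, forall s s', {in T, forall t, 0 < (t - s) * (t - s')}} ->
  exists c0 c1 c2, [/\ {in S, forall s, 0 < quad c0 c1 c2 s},
    {in T, forall t, quad c0 c1 c2 t < 0} & exists x, quad c0 c1 c2 x != 0].
Proof.
case: S => [|x S] sep.
  exists (-1), 0, 0; split=> [//|t _|]; first by rewrite /quad; lra.
  by exists 0; rewrite /quad !mul0r !addr0 oppr_eq0 oner_eq0.
have [m mS mle] := seq_min x S; have [n nS nge] := seq_max x S.
have [d d_gt0 dle] := pos_lower_bound (sep m n mS nS).
exists (d / 2 - m * n), (m + n), (-1).
have quadE t : quad (d / 2 - m * n) (m + n) (-1) t = d / 2 - (t - m) * (t - n).
  by rewrite /quad; ring.
split=> [s sS|t tT|].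
- have sm : 0 <= s - m by rewrite subr_ge0 mle.
  have ns : 0 <= n - s by rewrite subr_ge0 nge.
  by rewrite quadE; have := mulr_ge0 sm ns; lra.
- by rewrite quadE; have := dle t tT; lra.
- by exists m; rewrite quadE subrr mul0r subr0 gt_eqF //; lra.
Qed.

(** Points on a line that never interlace: if some [t] lies between two [s] and
some [s] between two [t], a crossing appears, so one of the two families is a
block to which [quad_separation_block] applies. The last clause has
content when both families are empty. *)
Lemma quad_separation S T : {in S & T, forall s t, s != t} ->
  {in S & S, forall s s', {in T & T, forall t t', 0 <= crossing s s' t t'}} ->
  exists c0 c1 c2, [/\ {in S, forall s, 0 < quad c0 c1 c2 s},
    {in T, forall t, quad c0 c1 c2 t < 0} & exists x, quad c0 c1 c2 x != 0].
Proof.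
move=> disj cross.
have [sep|] := pselect
    {in S & S, forall s s', {in T, forall t, 0 < (t - s) * (t - s')}}.
  exact: quad_separation_block.
have [sep _|nT] := pselect
    {in T & T, forall t t', {in S, forall s, 0 < (s - t) * (s - t')}}.
  have [c0 [c1 [c2 [pos neg [x fx]]]]] := quad_separation_block sep.
  have quadN t : quad (- c0) (- c1) (- c2) t = - quad c0 c1 c2 t.
    by rewrite /quad; ring.
  exists (- c0), (- c1), (- c2); split=> [s sS|t tT|].
  - by rewrite quadN oppr_gt0 neg.
  - by rewrite quadN oppr_lt0 pos.
  - by exists x; rewrite quadN oppr_eq0.
move=> nS; exfalso.
have between (A B : seq R) :
    ~ {in A & A, forall s s', {in B, forall t, 0 < (t - s) * (t - s')}} ->
    {in A & B, forall s t, s != t} ->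
    exists s s' t, [/\ s \in A, s' \in A, t \in B & s < t < s'].
  move=> nAB dAB; apply: contrapT => none; apply: nAB => s s' sA s'A t tB.
  rewrite ltNge; apply/negP => le0; apply: none.
  have := dAB s t sA tB; have := dAB s' t s'A tB.
  rewrite !neq_lt => /orP[] st' /orP[] st.
  - by rewrite -subr_gt0 in st; rewrite -subr_gt0 in st'; have := mulr_gt0 st st'; lra.
  - by exists s', s, t; split=> //; rewrite st'.
  - by exists s, s', t; split=> //; rewrite st.
  - by rewrite -subr_gt0 in st; rewrite -subr_gt0 in st'; have := mulr_gt0 st st'; lra.
have [s1 [s2 [t [s1S s2S tT /andP[s1t ts2]]]]] := between S T nS disj.
have disj' : {in T & S, forall t s, t != s}.
  by move=> u v uT vS; rewrite eq_sym disj.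
have [t1 [t2 [s [t1T t2T sS /andP[t1s st2]]]]] := between T S nT disj'.
(* No crossing with [t] means that all of [T] lies between [s1] and [s2]. *)
have inside u : u \in T -> s1 < u < s2.
  move=> uT; have := cross s1 s2 s1S s2S t u tT uT.
  have := disj s1 u s1S uT; have := disj s2 u s2S uT.
  rewrite /crossing => us2 us1 cr.
  rewrite -subr_gt0 in s1t; rewrite -subr_gt0 in ts2.
  have c0 : 0 <= (s1 - u) * (u - s2).
    rewrite -(pmulr_rge0 _ (mulr_gt0 s1t ts2)).
    by move: cr; congr (_ <= _); ring.
  have {c0} : 0 < (u - s1) * (s2 - u).
    rewrite lt0r mulf_neq0 ?subr_eq0 //=; last by rewrite eq_sym.
    by move: c0; congr (_ <= _); ring.
  have [le1|lt1] := leP u s1.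
    have lt2 : u < s2 by lra.
    by rewrite pmulr_lgt0 ?subr_gt0 // ltNge le1.
  by rewrite pmulr_rgt0 ?subr_gt0.
have /andP[l1 _] := inside _ t1T; have /andP[l3 _] := inside _ t2T.
have := cross s1 s s1S sS t1 t2 t1T t2T; rewrite /crossing leNgt => /negP; apply.
rewrite -subr_gt0 in l1; rewrite -subr_gt0 in l3.
rewrite -subr_gt0 in t1s; rewrite -subr_gt0 in st2.
have := mulr_gt0 (mulr_gt0 l1 st2) (mulr_gt0 l3 t1s).
by rewrite -oppr_gt0; congr (_ < _); ring.
Qed.

(** Each of the three expressions is a square times [W P], [- W Q] and [- P Q]
respectively, in the notation of the proof; the powers of the scaling factors
[k, m, y, u] are all even. As [W = P - Q], if [P] and [Q] have opposite signs
then [W] has the sign of [P]. *)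
Lemma sign_conditions (k m y2 y3 u2 u3 s2 s3 r2 r3 : R) :
  k != 0 -> m != 0 -> y2 != 0 -> y3 != 0 -> u2 != 0 -> u3 != 0 ->
  s2 != s3 -> s2 != r2 -> s3 != r2 ->
  [/\ 0 < - ((- (m * u3) * (u2 * u3 * (r2 - r3)) * (k * u3) * (y3 * u3 * (s3 - r3)))
      / (k * y2 * (y2 * y3 * (s2 - s3)) * (m * y2) * (y2 * u2 * (s2 - r2)))),
    0 < (- (m * u3) * (u2 * u3 * (r2 - r3)) * (k * u3) * (y2 * u3 * (s2 - r3)))
      / (k * y3 * (y2 * y3 * (s2 - s3)) * (m * y3) * (y3 * u2 * (s3 - r2)))
  & 0 < - ((- (m * u3) * (k * u3) * (y2 * u3 * (s2 - r3)) * (y3 * u3 * (s3 - r3)))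
      / (- (m * u2) * (k * u2) * (y2 * u2 * (s2 - r2)) * (y3 * u2 * (s3 - r2))))]
  <-> crossing s2 s3 r2 r3 < 0.
Proof.
move=> k0 m0 y20 y30 u20 u30.
rewrite -[s2 == s3]subr_eq0 -[s2 == r2]subr_eq0 -[s3 == r2]subr_eq0.
move=> ss n22 n32.
set P := (s2 - r2) * (s3 - r3); set Q := (s2 - r3) * (s3 - r2).
set W := (s2 - s3) * (r2 - r3).
have WE : W = P - Q by rewrite /W /P /Q; ring.
have scale_gt0 (v w z z' : R) : v != 0 -> w != 0 -> z != 0 -> z' != 0 ->
    0 < ((v / w) ^+ 2 / (z * z')) ^+ 2.
  move=> v0 w0 z0 z0'.
  by rewrite sqr_gt0 // mulf_neq0 ?invr_eq0 ?expf_neq0 ?mulf_neq0 ?invr_eq0.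
set c1 := - _; set c2 := _ / _; set c3 := - _.
have -> : (0 < c1) = (0 < W * P).
  have -> : c1 = ((u3 / y2) ^+ 2 / ((s2 - s3) * (s2 - r2))) ^+ 2 * (W * P).
    by rewrite /c1 /W /P; field; rewrite ss n22 y20 y30 u20 k0 m0.
  by rewrite pmulr_rgt0 // scale_gt0.
have -> : (0 < c2) = (W * Q < 0).
  have -> : c2 = - (((u3 / y3) ^+ 2 / ((s2 - s3) * (s3 - r2))) ^+ 2 * (W * Q)).
    by rewrite /c2 /W /Q; field; rewrite ss n32 y20 y30 u20 k0 m0.
  by rewrite oppr_gt0 pmulr_rlt0 // scale_gt0.
have -> : (0 < c3) = (P * Q < 0).
  have -> : c3 = - (((u3 / u2) ^+ 2 / ((s2 - r2) * (s3 - r2))) ^+ 2 * (P * Q)).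
    by rewrite /c3 /P /Q; field; rewrite n22 n32 y20 y30 u20 k0 m0.
  by rewrite oppr_gt0 pmulr_rlt0 // scale_gt0.
rewrite /crossing -/P -/Q WE.
split=> [[]//|PQ]; split=> //.
  by have := sqr_ge0 P; lra.
by have := sqr_ge0 Q; lra.
Qed.

End Quadratics.

(** * The quartic form of a linear map and its expression in a rotated frame *)

Section Coordinates.
Variable R : realType.
Implicit Types (u v w e : 'cV[R]_2) (X Y : 'M[R]_2) (D : 'M[R]_3) (x y s : R).

Lemma sqrt2_sq : Num.sqrt (2 : R) * Num.sqrt 2 = 2.
Proof. by rewrite -expr2 sqr_sqrtr. Qed.

Lemma sqrt2_neq0 : Num.sqrt (2 : R) != 0.
Proof. by rewrite gt_eqF // sqrtr_gt0. Qed.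

Lemma svec_dot X Y : sym X -> sym Y ->
  (svec X *m (svec Y)^T) 0 0 = Defs.dotmx X Y.
Proof.
move=> sX sY; rewrite dotmx_sym // mxE sum_ord3 !mxE /=.
by have := sqrt2_sq; move: (Num.sqrt 2) => r <-; ring.
Qed.

(** The inverse of [svec] on symmetric matrices. *)
Definition smat (r : 'rV[R]_3) : 'M[R]_2 :=
  \matrix_(i, j) (if i == j then if i == 0 then r 0 0 else r 0 1
                  else r 0 2 / Num.sqrt 2).

Lemma sym_smat r : sym (smat r).
Proof. by apply/symE; rewrite !mxE. Qed.

Lemma smatK r : svec (smat r) = r.
Proof.
apply/rowP => j; elim/ord3P: j; rewrite !mxE //=.
by rewrite mulrC divfK ?sqrt2_neq0.
Qed.

Lemma svec_inj X Y : sym X -> sym Y -> svec X = svec Y -> X = Y.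
Proof.
move=> sX sY /rowP E; apply: matP2 => //.
- by have := E 0; rewrite !mxE.
- by have := E 1; rewrite !mxE.
- by have := E 2; rewrite !mxE /= => /(mulfI sqrt2_neq0).
Qed.

Lemma svecZ (c : R) X : svec (c *: X) = c *: svec X.
Proof. by apply/rowP => j; elim/ord3P: j; rewrite !mxE //=; ring. Qed.

(** The image under [svec] of the rank one matrix with factor [(x, y)]. *)
Definition svec_sq x y : 'rV[R]_3 := \row_j [:: x ^+ 2; y ^+ 2; Num.sqrt 2 * (x * y)]`_j.

Definition svec_outer v : 'rV[R]_3 := svec (v *m v^T).

Lemma svec_outerE v : svec_outer v = svec_sq (v 0 0) (v 1 0).
Proof. by apply/rowP => j; rewrite mxE [RHS]mxE !outerE !expr2. Qed.

Lemma svec_sqZ (k x y : R) : svec_sq (k * x) (k * y) = k ^+ 2 *: svec_sq x y.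
Proof. by apply/rowP => j; elim/ord3P: j; rewrite !mxE /=; ring. Qed.

Lemma svec_outerZ (k : R) v : svec_outer (k *: v) = k ^+ 2 *: svec_outer v.
Proof. by rewrite !svec_outerE -svec_sqZ !mxE. Qed.

(** The form [<L (v v^T), (J v)(J v)^T>] that governs rank one factors of both
families, where [L] is the linear map with matrix [D]. *)
Definition quartic D v : R := (svec_outer v *m D *m (svec_outer (perp v))^T) 0 0.

Lemma perpZ (k : R) v : perp (k *: v) = k *: perp v.
Proof. by apply: colP2; rewrite !mxE //= mulrN. Qed.

Lemma svec_outer_perpK v : svec_outer (perp (perp v)) = svec_outer v.
Proof.
rewrite !svec_outerE !(perp0, perp1) -[- v 0 0]mulN1r -[- v 1 0]mulN1r svec_sqZ.
by rewrite sqrrN expr1n scale1r.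
Qed.

Lemma quarticZ D (k : R) v : quartic D (k *: v) = k ^+ 4 * quartic D v.
Proof.
rewrite /quartic perpZ !svec_outerZ linearZ /= -!scalemxAl -scalemxAr !mxE; ring.
Qed.

Definition frame e x y : 'cV[R]_2 := x *: e + y *: perp e.

Lemma perp_frame e x y : perp (frame e x y) = frame e (- y) x.
Proof. by apply: colP2; rewrite !mxE /=; ring. Qed.

Lemma frame_coord e v : dotv e e = 1 ->
  v = frame e (dotv v e) (dotv v (perp e)).
Proof.
rewrite !dotvE !mxE /= => e1; apply: colP2; rewrite !mxE /=.
  by rewrite -[LHS]mulr1 -e1; ring.
by rewrite -[LHS]mulr1 -e1; ring.
Qed.

Lemma dot_frame e x y x' y' : dotv e e = 1 ->
  dotv (frame e x y) (frame e x' y') = x * x' + y * y'.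
Proof. by rewrite !dotvE !mxE /= => e1; rewrite -[RHS]mulr1 -e1; ring. Qed.

Lemma det_frame e x y x' y' : dotv e e = 1 ->
  det2 (frame e x y) (frame e x' y') = x * y' - y * x'.
Proof. by rewrite det2E !dotvE !mxE /= => e1; rewrite -[RHS]mulr1 -e1; ring. Qed.

(** The matrix in [svec] coordinates of [X |-> G X G^T], where [G] has
columns [e] and [J e]; it is a rotation when [e] is a unit vector. *)
Definition frame_rot e : 'M[R]_3 :=
  let p := e 0 0 in let q := e 1 0 in let r := Num.sqrt 2 * (p * q) in
  \matrix_(i, j) [:: svec_sq p q 0 j; svec_sq (- q) p 0 j; [:: - r; r; p ^+ 2 - q ^+ 2]`_j]`_i.

Lemma svec_outer_frame e x y : svec_outer (frame e x y) = svec_sq x y *m frame_rot e.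
Proof.
rewrite svec_outerE; apply/rowP => j; rewrite [RHS]mxE sum_ord3 !mxE /=.
elim/ord3P: j; rewrite ?mxE /=; rewrite -?[- (Num.sqrt 2 * _)]mulrN.
- have -> : Num.sqrt 2 * (x * y) * (Num.sqrt 2 * - (e 0 0 * e 1 0))
    = (Num.sqrt 2 * Num.sqrt 2) * (x * y * - (e 0 0 * e 1 0)) by ring.
  by rewrite sqrt2_sq; ring.
- have -> : Num.sqrt 2 * (x * y) * (Num.sqrt 2 * (e 0 0 * e 1 0))
    = (Num.sqrt 2 * Num.sqrt 2) * (x * y * (e 0 0 * e 1 0)) by ring.
  by rewrite sqrt2_sq; ring.
- by ring.
Qed.

(** Conjugation by a rotation is an isometry of symmetric matrices. *)
Lemma frame_rot_orth e : dotv e e = 1 -> frame_rot e *m (frame_rot e)^T = 1%:M.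
Proof.
rewrite dotvE; set p := e 0 0; set q := e 1 0 => e1.
(* The diagonal entries are [(p^2 + q^2)^2], so 1 is rewritten in that form. *)
have e2 : 1 = (p ^+ 2 + q ^+ 2) ^+ 2 :> R by rewrite !expr2 e1 mulr1.
apply/matrixP => i j; rewrite mxE sum_ord3.
have := sqrt2_sq.
elim/ord3P: i; elim/ord3P: j; rewrite !mxE /= -/p -/q;
  move: (Num.sqrt 2) => r r2; rewrite ?mulr1n ?mulr0n ?e2; ring: r2.
Qed.

Lemma quartic_frame D e x y : quartic D (frame e x y)
  = (svec_sq x y *m (frame_rot e *m D *m (frame_rot e)^T) *m (svec_sq (- y) x)^T) 0 0.
Proof. by rewrite /quartic perp_frame !svec_outer_frame trmx_mul !mulmxA. Qed.

(** The three vanishing entries say that [E_11] is an eigenvector of [D] and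
[E_22] one of its transpose; they remove the terms of degree 3 and 4. *)
Lemma quartic_quad D s : D 0 1 = 0 -> D 0 2 = 0 -> D 2 1 = 0 ->
  (svec_sq s 1 *m D *m (svec_sq (-1) s)^T) 0 0
  = quad (D 1 0) (Num.sqrt 2 * (D 2 0 - D 1 2)) (D 0 0 + D 1 1 - 2 * D 2 2) s.
Proof.
move=> d01 d02 d21; rewrite mxE sum_ord3 !(mxE, sum_ord3) /= d01 d02 d21 /quad.
by have := sqrt2_sq; move: (Num.sqrt 2) => r <-; ring.
Qed.

End Coordinates.

(** * Motions as 3 x 3 matrices *)

Section Motions.
Variables (R : realType) (p q : nat).
Implicit Types (M : 'M[R]_(p, q)) (A dA : 'I_p -> 'M[R]_2) (B dB : 'I_q -> 'M[R]_2).
Implicit Types (D : 'M[R]_3) (a b v e : 'cV[R]_2).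

(** With rows [svec (A i)], this turns a factorization into a product
[factor_mx A *m (factor_mx B)^T] through a space of dimension 3. *)
Definition factor_mx n (A : 'I_n -> 'M[R]_2) : 'M[R]_(n, 3) :=
  \matrix_(i, j) svec (A i) 0 j.

Lemma row_factor_mx n (A : 'I_n -> 'M[R]_2) i : row i (factor_mx A) = svec (A i).
Proof. by apply/rowP => j; rewrite !mxE. Qed.

(** The product has rank 3, the common dimension, so both factors have full
column rank. *)
Lemma factor_mx_left_inverses M A B : psd_factorization M A B -> \rank M = 3%N ->
  (exists LA, LA *m factor_mx A = 1%:M) /\ (exists LB, LB *m factor_mx B = 1%:M).
Proof.
case=> pA pB ME rkM.
have E : M = factor_mx A *m (factor_mx B)^T.
  apply/matrixP => i j; rewrite ME -svec_dot; last exact: (pB j).1.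
    by rewrite -!row_factor_mx !mxE; apply: eq_bigr => k _; rewrite !mxE.
  exact: (pA i).1.
have full n (X : 'M[R]_(n, 3)) : (3 <= \rank X)%N -> exists L, L *m X = 1%:M.
  by move=> rkX; apply/row_fullP; rewrite /row_full eqn_leq rank_leq_col.
have {}rkM : (3 <= \rank M)%N by rewrite rkM.
split; apply: full; apply: (leq_trans rkM); rewrite E; first exact: mxrankM_maxl.
by rewrite -[leqRHS](mxrank_tr (factor_mx B)); apply: mxrankM_maxr.
Qed.

(** Differentiating [M = X Y^T] gives [dX Y^T = - X dY^T]; cancelling [Y^T] on the
right yields [dX = X D], then cancelling [X] on the left yields the other
formula. *)
Lemma motion_matrix M A B dA dB : psd_factorization M A B -> \rank M = 3%N ->
  inf_motion2 A B dA dB -> exists D, motion_given_by D A B dA dB.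
Proof.
move=> fac rkM [sdA sdB bal _].
have [[LA LA1] [LB LB1]] := factor_mx_left_inverses fac rkM.
have [pA pB _] := fac.
have LB1' : (factor_mx B)^T *m LB^T = 1%:M by rewrite -trmx_mul LB1 trmx1.
have balM : factor_mx dA *m (factor_mx B)^T + factor_mx A *m (factor_mx dB)^T = 0.
  apply/matrixP => i j; rewrite [RHS]mxE -(bal i j) -!svec_dot //;
    try exact: (pA i).1; try exact: (pB j).1.
  by rewrite -!row_factor_mx !mxE; congr (_ + _); apply: eq_bigr => k _; rewrite !mxE.
have [D dAE] : exists D, factor_mx dA = factor_mx A *m D.
  exists (- (factor_mx dB)^T *m LB^T).
  rewrite -[LHS]mulmx1 -LB1' !mulmxA; congr (_ *m _).
  by rewrite mulmxN; apply/eqP; rewrite -subr_eq0 opprK balM.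
have dBE : (factor_mx dB)^T = - (D *m (factor_mx B)^T).
  rewrite -[LHS]mul1mx -LA1 -[in RHS](mul1mx D) -LA1 -!mulmxA -mulmxN; congr (_ *m _).
  rewrite [factor_mx A *m (D *m _)]mulmxA -dAE.
  by apply/eqP; rewrite -subr_eq0 opprK addrC balM.
exists D; split=> // [i|j]; first by rewrite -!row_factor_mx dAE row_mul.
apply/colP => k; move/matrixP/(_ k j): dBE; rewrite -!row_factor_mx !mxE => ->.
by congr (- _); apply: eq_bigr => l _; rewrite !mxE.
Qed.

Lemma motion_matrix_unique M A B dA dB D D' : psd_factorization M A B ->
  \rank M = 3%N -> motion_given_by D A B dA dB -> motion_given_by D' A B dA dB -> D = D'.
Proof.
move=> fac rkM [_ _ mA _] [_ _ mA' _].
have [[LA LA1] _] := factor_mx_left_inverses fac rkM.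
rewrite -(mul1mx D) -(mul1mx D') -LA1 -!mulmxA; congr (_ *m _).
by apply/row_matrixP => i; rewrite !row_mul !row_factor_mx -mA -mA'.
Qed.

Lemma rank1_motion_left A B dA dB D i a : motion_given_by D A B dA dB ->
  inf_motion2 A B dA dB -> A i = a *m a^T -> a != 0 ->
  0 <= quartic D a /\ (quartic D a = 0 -> exists c, svec_outer a *m D = c *: svec_outer a).
Proof.
move=> [sdA _ mA _] [_ _ _ [e e_gt0 feas]] Ai a0.
have qE : quartic D a = Defs.dotmx (dA i) (perp a *m (perp a)^T).
  by rewrite -svec_dot ?mA ?Ai //; exact: sym_outer.
rewrite qE; have [|ge0 eq0] := rank1_feasible a0 (sdA i) e_gt0.
  by move=> t t0 te; have [/(_ i)] := feas t t0 te; rewrite Ai.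
split=> // /eq0[c dAi]; exists c.
by rewrite /svec_outer -Ai -mA dAi Ai svecZ.
Qed.

Lemma rank1_motion_right A B dA dB D j b : motion_given_by D A B dA dB ->
  inf_motion2 A B dA dB -> B j = b *m b^T -> b != 0 ->
  quartic D (perp b) <= 0 /\
  (quartic D (perp b) = 0 -> exists c, D *m (svec_outer b)^T = c *: (svec_outer b)^T).
Proof.
move=> [_ sdB _ mB] [_ _ _ [e e_gt0 feas]] Bj b0.
have qE : quartic D (perp b) = - Defs.dotmx (dB j) (perp b *m (perp b)^T).
  have sp := sym_outer (perp b).
  rewrite -svec_dot // -[_ *m _ in RHS]trmxK trmx_mul trmxK mB.
  rewrite mulmxN [(- _)^T]linearN /= [in RHS]mxE opprK.
  by rewrite [RHS]mxE /quartic svec_outer_perpK /svec_outer -Bj mulmxA.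
rewrite qE; have [|ge0 eq0] := rank1_feasible b0 (sdB j) e_gt0.
  by move=> t t0 te; have [_ /(_ j)] := feas t t0 te; rewrite Bj.
split; first by rewrite oppr_le0.
move=> /eqP; rewrite oppr_eq0 => /eqP /eq0[c dBj]; exists (- c).
by rewrite /svec_outer -Bj -[LHS]opprK -mB dBj -Bj svecZ linearZ scaleNr.
Qed.

(** The balance equation is automatic for a motion given by a matrix, so only
positivity has to be checked, factor by factor; finitely many factors leave a
common time interval. *)
Lemma motion_of_conditions M A B D : psd_factorization M A B ->
  (forall i, [\/ 0 < \det (A i), exists c, svec (A i) *m D = c *: svec (A i)
     | exists2 a, A i = a *m a^T & 0 < quartic D a]) ->
  (forall j, [\/ 0 < \det (B j), exists c, D *m (svec (B j))^T = c *: (svec (B j))^T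
     | exists2 b, B j = b *m b^T & quartic D (perp b) < 0]) ->
  exists dA dB, motion_given_by D A B dA dB /\ inf_motion2 A B dA dB.
Proof.
move=> [pA pB _] cA cB.
pose dA i := smat (svec (A i) *m D).
pose dB j := smat (- (D *m (svec (B j))^T)^T).
have mA i : svec (dA i) = svec (A i) *m D by rewrite smatK.
have mB j : svec (dB j) = - (D *m (svec (B j))^T)^T by rewrite smatK.
have mot : motion_given_by D A B dA dB.
  split=> // [i|j|j]; try exact: sym_smat.
  by rewrite mB linearN /= trmxK.
exists dA, dB; split=> //.
have sA i := (pA i).1; have sB j := (pB j).1.
have sdA i : sym (dA i) := sym_smat _; have sdB j : sym (dB j) := sym_smat _.
have zeroA n (X dX : 'I_n -> 'M[R]_2) i (E : 'M[R]_3) : sym (dX i) ->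
    svec (dX i) = svec (X i) *m E -> X i = 0 -> dX i = 0.
  move=> sdX dXE X0; apply: svec_inj; rewrite // ?dXE ?X0 /sym ?trmx0 //.
  by rewrite -(scale0r (0 : 'M_2)) svecZ !scale0r mul0mx.
have eA i : exists e : R, 0 < e /\ forall t, 0 <= t -> t < e -> psd (A i + t *: dA i).
  suff [e e0 H] : exists2 e : R, 0 < e & forall t, 0 <= t -> t < e -> psd (A i + t *: dA i).
    by exists e.
  apply: feasible_of_conditions => //; first exact: zeroA (mA i).
  case: (cA i) => [d|[c Ec]|[a Ai q_gt0]]; [exact: Or31| |].
    apply: Or33; exists c; apply: svec_inj => //; first exact: symZ.
    by rewrite svecZ mA.
  apply: Or32; rewrite Ai det_polar_outer // -svec_dot //; last exact: sym_outer.
  by rewrite mA Ai.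
have eB j : exists e : R, 0 < e /\ forall t, 0 <= t -> t < e -> psd (B j + t *: dB j).
  suff [e e0 H] : exists2 e : R, 0 < e & forall t, 0 <= t -> t < e -> psd (B j + t *: dB j).
    by exists e.
  apply: feasible_of_conditions => //.
    by apply: (zeroA _ _ _ _ (- D^T)) => //; rewrite mB trmx_mul trmxK mulmxN.
  case: (cB j) => [d|[c Ec]|[b Bj q_lt0]]; [exact: Or31| |].
    apply: Or33; exists (- c); apply: svec_inj => //; first exact: symZ.
    by rewrite svecZ mB Ec linearZ /= trmxK scaleNr.
  apply: Or32; rewrite Bj det_polar_outer // -svec_dot //; last exact: sym_outer.
  have -> : svec (dB j) = - (svec_outer b *m D^T) by rewrite mB Bj trmx_mul trmxK.
  rewrite mulNmx mxE oppr_gt0; move: q_lt0; rewrite /quartic svec_outer_perpK.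
  have tr00 (X : 'M[R]_1) : X 0 0 = X^T 0 0 by rewrite mxE.
  by rewrite tr00 !trmx_mul !trmxK mulmxA.
have [eps1 /all_and2[eps1_gt0 H1]] := fin_all_exists eA.
have [eps2 /all_and2[eps2_gt0 H2]] := fin_all_exists eB.
split=> //.
  move=> i j; rewrite -!svec_dot // mA mB linearN /= trmxK mulmxN mulmxA.
  by rewrite [X in _ + X]mxE subrr.
have [e1 e1_gt0 le1] := @pos_lower_bound _ _ (enum 'I_p) eps1 (fun i _ => eps1_gt0 i).
have [e2 e2_gt0 le2] := @pos_lower_bound _ _ (enum 'I_q) eps2 (fun i _ => eps2_gt0 i).
exists (Num.min e1 e2); first by rewrite lt_min e1_gt0.
move=> t t0; rewrite lt_min => /andP[te1 te2]; split=> [i|j].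
  by apply: H1 => //; apply: lt_le_trans te1 _; apply: le1; rewrite mem_enum.
by apply: H2 => //; apply: lt_le_trans te2 _; apply: le2; rewrite mem_enum.
Qed.

(** Every matrix is an eigenvector of a scalar map, so the conditions of
[motion_of_conditions] hold for all factorizations at once. *)
Lemma scalar_motion_trivial A B dA dB (c : R) :
  motion_given_by c%:M A B dA dB -> trivial2 A B dA dB.
Proof.
move=> mot; exists c%:M => // M' A' B' _ fac.
apply: (motion_of_conditions fac) => [i|j]; apply: Or32; exists c.
  by rewrite mul_mx_scalar.
by rewrite mul_scalar_mx.
Qed.

Lemma psd_conj (h X : 'M[R]_2) : psd X -> psd (h *m X *m h^T).
Proof.
move=> [sX pX]; split; first by rewrite /sym !trmx_mul trmxK sX mulmxA.
move=> v; have := pX (h^T *m v).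
by rewrite /dotv trmx_mul trmxK !mulmxA.
Qed.

(** Rotating the given factorization yields another factorization of [M], with
orthogonal rank one factors at any prescribed position; there the conditions
from the two families are opposite inequalities on [quartic D]. *)
Lemma trivial_quartic_eq0 M A B D i j a b : in_M32 M -> psd_factorization M A B ->
  A i = a *m a^T -> B j = b *m b^T -> a != 0 -> b != 0 -> dotv a b = 0 ->
  (forall (M' : 'M[R]_(p, q)) A' B', in_M32 M' -> psd_factorization M' A' B' ->
    exists dA' dB', motion_given_by D A' B' dA' dB' /\ inf_motion2 A' B' dA' dB') ->
  forall v, v != 0 -> quartic D v = 0.
Proof.
move=> inM [pA pB ME] Ai Bj a0 b0 ab triv v v0.
have quartic_unit0 e : dotv e e = 1 -> quartic D e = 0.
  move=> e1.
  pose n := Num.sqrt (dotv a a).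
  have n_gt0 : 0 < n by rewrite sqrtr_gt0 sq_norm_gt0.
  have n2 : n ^+ 2 = dotv a a by rewrite sqr_sqrtr // ltW // sq_norm_gt0.
  have n0 : n != 0 by rewrite gt_eqF.
  (* The rotation that carries the direction of [a] to [e]. *)
  pose h : 'M[R]_2 := n^-1 *: (e *m a^T + perp e *m (perp a)^T).
  have hE k l : h k l = n^-1 * (e k 0 * a l 0 + perp e k 0 * perp a l 0).
    by rewrite !mxE !big_ord1 !mxE.
  have hh : h^T *m h = 1%:M.
    move: e1 n2; rewrite !dotvE => e1 n2.
    have nn : n^-1 ^+ 2 * (a 0 0 * a 0 0 + a 1 0 * a 1 0) = 1.
      by rewrite -n2 exprVn mulVf ?expf_neq0.
    have n3 : n^-1 ^+ 2 * (a 0 0 * a 0 0 + a 1 0 * a 1 0)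
        * (e 0 0 * e 0 0 + e 1 0 * e 1 0) = 1.
      by rewrite e1 mulr1.
    apply/matrixP => k l; rewrite mxE sum_ord2 ![h^T _ _]mxE !hE !perp0 !perp1.
    elim/ord2P: k; elim/ord2P: l; rewrite !mxE /= ?mulr1n ?mulr0n ?perp0 ?perp1; try ring.
      by rewrite -n3; ring.
    by rewrite -n3; ring.
  have ha : h *m a = n *: e.
    apply: colP2; rewrite !mxE sum_ord2 !hE !perp0 !perp1; move: n2; rewrite dotvE => n2.
      by apply: (mulfI n0); rewrite [RHS]mulrA -expr2 n2; field.
    by apply: (mulfI n0); rewrite [RHS]mulrA -expr2 n2; field.
  pose s := dotv (perp a) b / n.
  have hb : h *m b = s *: perp e.
    rewrite /s; move: ab; rewrite !dotvE => ab; apply: colP2;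
      rewrite !mxE sum_ord2 !hE !perp0 !perp1 /=.
      apply/eqP; rewrite -subr_eq0; apply/eqP.
      by rewrite -[RHS](mulr0 (n^-1 * e 0 0)) -ab; ring.
    apply/eqP; rewrite -subr_eq0; apply/eqP.
    by rewrite -[RHS](mulr0 (n^-1 * e 1 0)) -ab; ring.
  have s0 : s != 0.
    apply: contra b0 => /eqP sE; apply/eqP.
    by rewrite -[b]mul1mx -hh -mulmxA hb sE scale0r mulmx0.
  pose A' i := h *m A i *m h^T; pose B' j := h *m B j *m h^T.
  have fac' : psd_factorization M A' B'.
    split=> [k|l|k l]; try exact: psd_conj.
    rewrite ME /Defs.dotmx.
    have -> : A' k *m B' l = h *m (A k *m B l *m h^T).
      by rewrite /A' /B' -!mulmxA (mulmxA h^T) hh mul1mx.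
    by rewrite [RHS]mxtrace_mulC -[_ *m h^T *m h]mulmxA hh mulmx1.
  have [dA [dB [mot infm]]] := triv _ _ _ inM fac'.
  have e0 : e != 0.
    by apply: contra_eqN e1 => /eqP ->; rewrite dotvE !mxE mulr0 addr0 eq_sym oner_eq0.
  have pe0 : perp e != 0.
    apply: contra e0 => /eqP pe; apply/eqP; apply: colP2; rewrite mxE.
      by rewrite -perp1 pe mxE.
    by apply: oppr_inj; rewrite -perp0 pe mxE oppr0.
  have [||ge0 _] := rank1_motion_left (i := i) (a := n *: e) mot infm.
  - by rewrite /A' Ai -ha trmx_mul !mulmxA.
  - by rewrite scaler_eq0 negb_or n0.
  have [||le0 _] := rank1_motion_right (j := j) (b := s *: perp e) mot infm.
  - by rewrite /B' Bj -hb trmx_mul !mulmxA.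
  - by rewrite scaler_eq0 negb_or s0.
  move: ge0 le0; rewrite perpZ !quarticZ.
  have -> : perp (perp e) = -1 *: e by apply: colP2; rewrite !mxE /=; ring.
  rewrite quarticZ -signr_odd expr0 mul1r pmulr_rge0 ?pow4_gt0 // pmulr_rle0 ?pow4_gt0 //.
  by move=> ge le; apply/eqP; rewrite eq_le ge le.
have v_gt0 := sq_norm_gt0 v0.
pose n := Num.sqrt (dotv v v).
have n_gt0 : 0 < n by rewrite sqrtr_gt0.
have -> : v = n *: (n^-1 *: v) by rewrite scalerA divff ?scale1r ?gt_eqF.
rewrite quarticZ quartic_unit0 ?mulr0 //.
have n2 : n * n = dotv v v by rewrite -expr2 sqr_sqrtr // ltW.
move: n2; rewrite !dotvE !mxE => n2.
have -> : n^-1 * v 0 0 * (n^-1 * v 0 0) + n^-1 * v 1 0 * (n^-1 * v 1 0)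
  = (n * n)^-1 * (v 0 0 * v 0 0 + v 1 0 * v 1 0) by field; rewrite gt_eqF.
by rewrite -n2 mulVf // mulf_neq0 // gt_eqF.
Qed.

End Motions.

(** * Motions in a frame adapted to the orthogonal pair *)

Section Normalized.
Variable R : realType.
Implicit Types (e v : 'cV[R]_2) (X : 'M[R]_2) (D E : 'M[R]_3) (x y s k : R).

Lemma rank_neq1_psd X : psd X -> \rank X <> 1%N -> X = 0 \/ 0 < \det X.
Proof.
move=> /psd_tr_det[_ _ detX] rk1.
have [X0|X0] := eqVneq X 0; [by left|right].
have rk2 : \rank X = 2%N.
  by move: (rank_leq_row X) rk1; rewrite -mxrank_eq0 in X0;
    case: (\rank X) X0 => [|[|[|]]].
have : X \in unitmx by rewrite -row_full_unit /row_full rk2.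
by rewrite unitmxE unitfE lt0r => ->.
Qed.

(** The matrix of the same linear map on symmetric matrices in the frame
[e, J e]. *)
Definition in_frame e D := frame_rot e *m D *m (frame_rot e)^T.

Lemma in_frameK e D : dotv e e = 1 ->
  in_frame e ((frame_rot e)^T *m D *m frame_rot e) = D.
Proof.
move=> e1; rewrite /in_frame !mulmxA frame_rot_orth // mul1mx.
by rewrite -mulmxA frame_rot_orth // mulmx1.
Qed.

Lemma in_frame_scalar e D c : dotv e e = 1 -> in_frame e D = c%:M -> D = c%:M.
Proof.
move=> e1 E; have orth := mulmx1C (frame_rot_orth e1).
have -> : D = (frame_rot e)^T *m in_frame e D *m frame_rot e.
  by rewrite /in_frame !mulmxA orth mul1mx -mulmxA orth mulmx1.
by rewrite E mul_mx_scalar -scalemxAl orth scalemx1.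
Qed.

Lemma eigen_left_in_frame e D k x y : dotv e e = 1 -> k != 0 ->
  (exists c, svec_outer (k *: frame e x y) *m D = c *: svec_outer (k *: frame e x y)) ->
  exists c, svec_sq x y *m in_frame e D = c *: svec_sq x y.
Proof.
move=> e1 k0 [c]; rewrite svec_outerZ -scalemxAl scalerA [c * _]mulrC.
rewrite -[RHS]scalerA => E0.
have := scalerI (expf_neq0 2 k0) E0; rewrite svec_outer_frame => E.
exists c; rewrite /in_frame !mulmxA E -scalemxAl -mulmxA frame_rot_orth //.
by rewrite mulmx1.
Qed.

Lemma eigen_right_in_frame e D k x y : dotv e e = 1 -> k != 0 ->
  (exists c, D *m (svec_outer (k *: frame e x y))^T = c *: (svec_outer (k *: frame e x y))^T) ->
  exists c, in_frame e D *m (svec_sq x y)^T = c *: (svec_sq x y)^T.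
Proof.
move=> e1 k0 [c]; rewrite svec_outerZ linearZ /= -scalemxAr scalerA [c * _]mulrC.
rewrite -[RHS]scalerA => E0.
have := scalerI (expf_neq0 2 k0) E0; rewrite svec_outer_frame trmx_mul => E.
exists c; rewrite /in_frame -!mulmxA E -scalemxAr mulmxA frame_rot_orth //.
by rewrite mul1mx.
Qed.

Lemma quartic_slope e D k s : let E := in_frame e D in
  E 0 1 = 0 -> E 0 2 = 0 -> E 2 1 = 0 ->
  quartic D (k *: frame e s 1)
  = k ^+ 4 * quad (E 1 0) (Num.sqrt 2 * (E 2 0 - E 1 2)) (E 0 0 + E 1 1 - 2 * E 2 2) s.
Proof. by move=> E e01 e02 e21; rewrite quarticZ quartic_frame -quartic_quad. Qed.

(** The hypotheses are the eigenvector conditions at the orthogonal pair of rank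
one factors, in their frame. *)
Lemma fixed_flag_zeros E :
  (exists c, svec_sq 1 0 *m E = c *: svec_sq 1 0) ->
  (exists c, E *m (svec_sq 0 1)^T = c *: (svec_sq 0 1)^T) ->
  [/\ E 0 1 = 0, E 0 2 = 0 & E 2 1 = 0].
Proof.
move=> [c /rowP Ec] [d /colP Ed]; split.
- by have := Ec 1; rewrite mxE sum_ord3 !mxE /= => h; lra.
- by have := Ec 2; rewrite mxE sum_ord3 !mxE /= => h; lra.
- by have := Ed 2; rewrite mxE sum_ord3 !mxE /= => h; lra.
Qed.

(** Once the quadratic vanishes, [E] is the infinitesimal action
[X |-> S X + X S^T] of a triangular [S]. An eigenvector [v v^T] of that action
makes [v] an eigenvector of [S]; with [(1, 0)] and two other slopes, [S] has
three eigenlines and is scalar. *)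
Lemma scalar_of_two_slopes E s s' : s != s' ->
  E 0 1 = 0 -> E 0 2 = 0 -> E 2 1 = 0 ->
  E 1 0 = 0 -> Num.sqrt 2 * (E 2 0 - E 1 2) = 0 -> E 0 0 + E 1 1 - 2 * E 2 2 = 0 ->
  (exists c, svec_sq s 1 *m E = c *: svec_sq s 1) ->
  (exists c, svec_sq s' 1 *m E = c *: svec_sq s' 1) -> E = (E 1 1)%:M.
Proof.
move=> ss' e01 e02 e21 e10 c1 c2 [c /rowP Ec] [d /rowP Ed].
have e20 : E 2 0 = E 1 2.
  by apply/eqP; rewrite -subr_eq0; apply/eqP/(mulfI (sqrt2_neq0 R)); rewrite c1 mulr0.
have col2 x k : (forall j, (svec_sq x 1 *m E) 0 j = (k *: svec_sq x 1) 0 j) ->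
    E 1 2 = Num.sqrt 2 * x * (E 1 1 - E 2 2).
  move=> H; have := H 1; have := H 2; rewrite ![(_ *m _) _ _]mxE !sum_ord3 !mxE /=.
  rewrite e01 e02 e21 => h2 h1.
  have -> : E 1 1 = k by move: h1; move: (Num.sqrt 2) => r; lra.
  by move: h2; move: (Num.sqrt 2) => r; lra.
have e12 := col2 _ _ Ec; have e12' := col2 _ _ Ed.
have e22 : E 2 2 = E 1 1.
  apply/esym/eqP; rewrite -subr_eq0; apply/eqP.
  have n0 : Num.sqrt 2 * (s - s') != 0 by rewrite mulf_neq0 ?sqrt2_neq0 ?subr_eq0.
  apply: (mulfI n0); rewrite mulr0 -(subrr (E 1 2)) {1}e12 e12'; ring.
have e120 : E 1 2 = 0 by rewrite e12 e22 subrr mulr0.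
have e00 : E 0 0 = E 1 1 by rewrite e22 in c2; lra.
apply/matrixP => i j; rewrite mxE.
by elim/ord3P: i; elim/ord3P: j; rewrite /= ?mulr1n ?mulr0n // ?e20.
Qed.

End Normalized.

(** * Slopes of the rank one factors and rigidity *)

Section SlopeCoordinates.
Variables (R : realType) (pb qb : nat).
Variables (a : 'I_pb -> 'cV[R]_2) (b : 'I_qb -> 'cV[R]_2).
Variables (i1 : 'I_pb) (j1 : 'I_qb).

(** Rank one factors in the frame [e, J e]: [s i] is the slope of [a i] and [r j]
that of [perp (b j)], while [k, m, y, u] are scaling factors. Orthogonality of
[a i] and [b j] becomes equality of slopes. *)
Record slope_coordinates (e : 'cV[R]_2) (k m : R)
    (y s : 'I_pb -> R) (u r : 'I_qb -> R) : Prop := SlopeCoordinates {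
  sc_unit : dotv e e = 1;
  sc_k : k != 0; sc_m : m != 0;
  sc_a1 : a i1 = k *: frame e 1 0;
  sc_b1 : b j1 = m *: frame e 0 1;
  sc_y : forall i, i != i1 -> y i != 0;
  sc_u : forall j, j != j1 -> u j != 0;
  sc_a : forall i, i != i1 -> a i = y i *: frame e (s i) 1;
  sc_b : forall j, j != j1 -> b j = u j *: frame e 1 (- r j);
  sc_s : forall i i', i != i1 -> i' != i1 -> i != i' -> s i != s i';
  sc_r : forall j j', j != j1 -> j' != j1 -> j != j' -> r j != r j';
  sc_sr : forall i j, i != i1 -> j != j1 -> s i != r j }.

Hypotheses (a0 : a i1 != 0) (b0 : b j1 != 0).
Hypothesis h11 : dotv (a i1) (b j1) = 0.
Hypothesis hdeta : forall i j : 'I_pb, i <> j -> det2 (a i) (a j) <> 0.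
Hypothesis hdetb : forall i j : 'I_qb, i <> j -> det2 (b i) (b j) <> 0.
Hypothesis hdot : forall (i : 'I_pb) (j : 'I_qb),
  (i, j) <> (i1, j1) -> dotv (a i) (b j) <> 0.

Lemma dotvZ (x z : R) (v w : 'cV[R]_2) : dotv (x *: v) (z *: w) = x * z * dotv v w.
Proof. by rewrite !dotvE !mxE; ring. Qed.

Lemma det2Z (x z : R) (v w : 'cV[R]_2) : det2 (x *: v) (z *: w) = x * z * det2 v w.
Proof. by rewrite !det2E !mxE; ring. Qed.

Lemma slope_coordinates_exist : exists e k m y s u r, slope_coordinates e k m y s u r.
Proof.
pose k := Num.sqrt (dotv (a i1) (a i1)).
have k_gt0 : 0 < k by rewrite sqrtr_gt0 sq_norm_gt0.
have k0 : k != 0 by rewrite gt_eqF.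
pose e := k^-1 *: a i1.
have e1 : dotv e e = 1.
  by rewrite dotvZ -(sqr_sqrtr (ltW (sq_norm_gt0 a0))) -/k; field.
have aE : a i1 = k *: frame e 1 0.
  by rewrite /frame scale1r scale0r addr0 scalerA divff ?scale1r.
pose m := dotv (b j1) (perp e).
have bE : b j1 = m *: frame e 0 1.
  rewrite {1}(frame_coord (b j1) e1).
  have -> : dotv (b j1) e = 0.
    have : dotv (b j1) (k *: e) = 0.
      by rewrite /e scalerA divff // scale1r -h11 !dotvE; ring.
    rewrite -{1}[b j1]scale1r dotvZ mul1r => /eqP.
    by rewrite mulf_eq0 (negbTE k0) => /eqP.
  by rewrite /frame !scale0r !add0r scale1r.
have m0 : m != 0 by apply: contra b0; rewrite bE => /eqP ->; rewrite scale0r.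
pose y i := dotv (a i) (perp e).
pose s i := dotv (a i) e / y i.
pose u j := dotv (b j) e.
pose r j := - dotv (b j) (perp e) / u j.
have y0 i : i != i1 -> y i != 0.
  rewrite eq_sym => /eqP /hdeta; rewrite aE -[a i]scale1r det2Z (frame_coord (a i) e1).
  rewrite det_frame // -/(y i) => nz; apply/eqP => y0; apply: nz; rewrite y0; ring.
have u0 j : j != j1 -> u j != 0.
  rewrite eq_sym => /eqP /hdetb; rewrite bE -[b j]scale1r det2Z (frame_coord (b j) e1).
  rewrite det_frame // -/(u j) => nz; apply/eqP => u0; apply: nz; rewrite u0; ring.
have sa i : i != i1 -> a i = y i *: frame e (s i) 1.
  move=> /y0 yi; rewrite {1}(frame_coord (a i) e1) /frame scalerDr !scalerA mulr1.
  by rewrite /s [y i * _]mulrC divfK.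
have sb j : j != j1 -> b j = u j *: frame e 1 (- r j).
  move=> /u0 uj; rewrite {1}(frame_coord (b j) e1) /frame scalerDr !scalerA mulr1.
  by have -> : u j * - r j = dotv (b j) (perp e) by rewrite /r; field.
exists e, k, m, y, s, u, r; split=> //.
- move=> i i' ni ni' /eqP /hdeta; rewrite sa // (sa i') // det2Z det_frame //.
  by move=> nz; apply/eqP => ss; apply: nz; rewrite ss; ring.
- move=> j j' nj nj' /eqP /hdetb; rewrite sb // (sb j') // det2Z det_frame //.
  by move=> nz; apply/eqP => rr; apply: nz; rewrite rr; ring.
- move=> i j ni nj; have /hdot : (i, j) <> (i1, j1).
    by move=> [ii _]; rewrite ii eqxx in ni.
  rewrite sa // sb // dotvZ dot_frame // => nz.
  by apply/eqP => sr; apply: nz; rewrite sr; ring.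
Qed.

Lemma conditions_crossing e k m y s u r i2 i3 j2 j3 :
  slope_coordinates e k m y s u r ->
  i2 != i1 -> i3 != i1 -> i2 != i3 -> j2 != j1 -> j3 != j1 -> j2 != j3 ->
  [/\ 0 < - ((det2 (b j1) (b j3) * det2 (b j2) (b j3)
              * dotv (a i1) (b j3) * dotv (a i3) (b j3))
             / (det2 (a i1) (a i2) * det2 (a i2) (a i3)
              * dotv (a i2) (b j1) * dotv (a i2) (b j2))),
      0 < (det2 (b j1) (b j3) * det2 (b j2) (b j3)
              * dotv (a i1) (b j3) * dotv (a i2) (b j3))
             / (det2 (a i1) (a i3) * det2 (a i2) (a i3)
              * dotv (a i3) (b j1) * dotv (a i3) (b j2))
    & 0 < - ((det2 (b j1) (b j3)
              * dotv (a i1) (b j3) * dotv (a i2) (b j3) * dotv (a i3) (b j3))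
             / (det2 (b j1) (b j2)
              * dotv (a i1) (b j2) * dotv (a i2) (b j2)
              * dotv (a i3) (b j2)))]
  <-> crossing (s i2) (s i3) (r j2) (r j3) < 0.
Proof.
case=> e1 k0 m0 aE bE y0 u0 sa sb ss rr sr n2 n3 n23 m2 m3 m23.
have b1b j : j != j1 -> det2 (b j1) (b j) = - (m * u j).
  by move=> nj; rewrite bE sb // det2Z det_frame //; ring.
have bb j j' : j != j1 -> j' != j1 -> det2 (b j) (b j') = u j * u j' * (r j - r j').
  by move=> nj nj'; rewrite sb // (sb j') // det2Z det_frame //; ring.
have a1a i : i != i1 -> det2 (a i1) (a i) = k * y i.
  by move=> ni; rewrite aE sa // det2Z det_frame //; ring.
have aa i i' : i != i1 -> i' != i1 -> det2 (a i) (a i') = y i * y i' * (s i - s i').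
  by move=> ni ni'; rewrite sa // (sa i') // det2Z det_frame //; ring.
have a1b j : j != j1 -> dotv (a i1) (b j) = k * u j.
  by move=> nj; rewrite aE sb // dotvZ dot_frame //; ring.
have ab1 i : i != i1 -> dotv (a i) (b j1) = m * y i.
  by move=> ni; rewrite bE sa // dotvZ dot_frame //; ring.
have ab i j : i != i1 -> j != j1 -> dotv (a i) (b j) = y i * u j * (s i - r j).
  by move=> ni nj; rewrite sa // sb // dotvZ dot_frame //; ring.
rewrite !b1b // !bb // !a1a // !aa // !a1b // !ab1 // !ab //.
by apply: sign_conditions => //; auto.
Qed.

End SlopeCoordinates.

Section Rigidity.
Variables (R : realType) (p q : nat) (M : 'M[R]_(p, q)).
Variables (A : 'I_p -> 'M[R]_2) (B : 'I_q -> 'M[R]_2).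
Hypothesis (hM : in_M32 M) (hAB : psd_factorization M A B).
Variables (pb qb : nat) (hpb : (pb <= p)%N) (hqb : (qb <= q)%N).
Variables (a : 'I_pb -> 'cV[R]_2) (b : 'I_qb -> 'cV[R]_2).
Hypothesis (ha : forall i : 'I_pb, A (widen_ord hpb i) = a i *m (a i)^T).
Hypothesis (hb : forall j : 'I_qb, B (widen_ord hqb j) = b j *m (b j)^T).
Variables (i1 : 'I_pb) (j1 : 'I_qb).
Variables (e : 'cV[R]_2) (k m : R) (y s : 'I_pb -> R) (u r : 'I_qb -> R).
Hypothesis sc : slope_coordinates a b i1 j1 e k m y s u r.
Let e1 : dotv e e = 1 := sc_unit sc.

Lemma frame_neq0 (x z t : R) : x != 0 -> z ^+ 2 + t ^+ 2 != 0 -> x *: frame e z t != 0.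
Proof.
move=> x0; rewrite scaler_eq0 (negbTE x0) /=; apply: contra => /eqP f0.
by rewrite !expr2 -(dot_frame _ _ _ _ e1) f0 dotvE !mxE mulr0 addr0.
Qed.

Lemma sq1_neq0 (z : R) : z ^+ 2 + 1 != 0.
Proof. by rewrite gt_eqF //; have := sqr_ge0 z; lra. Qed.

Lemma perp_bE j : j != j1 -> perp (b j) = u j *: frame e (r j) 1.
Proof. by move=> nj; rewrite (sc_b sc) // perpZ perp_frame opprK. Qed.

(** At the pair [i1, j1] the two families impose opposite inequalities on the
quartic form, which then has a double root along [e]. *)
Lemma rigid_of_crossing i2 i3 j2 j3 :
  i2 != i1 -> i3 != i1 -> j2 != j1 -> j3 != j1 -> i2 != i3 ->
  crossing (s i2) (s i3) (r j2) (r j3) < 0 -> inf_rigid2 A B.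
Proof.
move=> n2 n3 m2 m3 n23 cr dA dB mot; have [_ rkM _] := hM.
have [D motD] := motion_matrix hAB rkM mot.
suff [c Dc] : exists c, D = c%:M.
  by apply: (@scalar_motion_trivial _ _ _ _ _ _ _ c); rewrite -Dc.
suff [c Ec] : exists c, in_frame e D = c%:M by exists c; apply: in_frame_scalar Ec.
set E := in_frame e D.
have left i v : a i = v -> v != 0 ->
    0 <= quartic D v /\ (quartic D v = 0 -> exists c, svec_outer v *m D = c *: svec_outer v).
  by move=> <- v0; apply: (rank1_motion_left motD mot) v0; exact: ha.
have right j v : b j = v -> v != 0 -> quartic D (perp v) <= 0 /\
    (quartic D (perp v) = 0 -> exists c, D *m (svec_outer v)^T = c *: (svec_outer v)^T).
  by move=> <- v0; apply: (rank1_motion_right motD mot) v0; exact: hb.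
have [|a1_ge0 a1_eig] := left i1 _ (sc_a1 sc).
  by rewrite frame_neq0 ?(sc_k sc) // expr0n addr0 expr1n oner_eq0.
have [|b1_le0 b1_eig] := right j1 _ (sc_b1 sc).
  by rewrite frame_neq0 ?(sc_m sc) // expr0n add0r expr1n oner_eq0.
have F0 : quartic D (frame e 1 0) = 0.
  apply/eqP; rewrite eq_le; move: a1_ge0 b1_le0.
  have -> : perp (m *: frame e 0 1) = - m *: frame e 1 0.
    by rewrite perpZ perp_frame; apply: colP2; rewrite !mxE; ring.
  rewrite !quarticZ pmulr_rge0 ?pow4_gt0 ?(sc_k sc) // => ->.
  by rewrite pmulr_rle0 ?pow4_gt0 ?oppr_eq0 ?(sc_m sc) // => ->.
have [E01 E02 E21] : [/\ E 0 1 = 0, E 0 2 = 0 & E 2 1 = 0].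
  apply: fixed_flag_zeros.
    apply: (eigen_left_in_frame e1 (sc_k sc)); apply: a1_eig.
    by rewrite quarticZ F0 mulr0.
  apply: (eigen_right_in_frame e1 (sc_m sc)); apply: b1_eig.
  have -> : perp (m *: frame e 0 1) = - m *: frame e 1 0.
    by rewrite perpZ perp_frame; apply: colP2; rewrite !mxE; ring.
  by rewrite quarticZ F0 mulr0.
have slopeE x z : quartic D (z *: frame e x 1) = z ^+ 4 * quad (E 1 0)
    (Num.sqrt 2 * (E 2 0 - E 1 2)) (E 0 0 + E 1 1 - 2 * E 2 2) x by exact: quartic_slope.
have a_nz i : i != i1 -> y i *: frame e (s i) 1 != 0.
  by move=> ni; rewrite frame_neq0 ?(sc_y sc) // expr1n sq1_neq0.
have pos i : i != i1 -> 0 <= quad (E 1 0)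
    (Num.sqrt 2 * (E 2 0 - E 1 2)) (E 0 0 + E 1 1 - 2 * E 2 2) (s i).
  move=> ni; have [] := left i _ (sc_a sc ni) (a_nz i ni).
  by rewrite slopeE pmulr_rge0 ?pow4_gt0 ?(sc_y sc).
have neg j : j != j1 -> quad (E 1 0)
    (Num.sqrt 2 * (E 2 0 - E 1 2)) (E 0 0 + E 1 1 - 2 * E 2 2) (r j) <= 0.
  move=> nj; have [] := right j (b j) erefl.
    by rewrite (sc_b sc) // frame_neq0 ?(sc_u sc) // sqrrN expr1n addrC sq1_neq0.
  by rewrite perp_bE // slopeE pmulr_rle0 ?pow4_gt0 ?(sc_u sc).
have [c0 c1 c2] := crossing_quad_eq0 cr (pos _ n2) (pos _ n3) (neg _ m2) (neg _ m3).
have eig i : i != i1 -> exists c, svec_sq (s i) 1 *m E = c *: svec_sq (s i) 1.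
  move=> ni; apply: (eigen_left_in_frame e1 (sc_y sc ni)).
  have [_] := left i _ (sc_a sc ni) (a_nz i ni); apply.
  by rewrite slopeE c0 c1 c2 /quad !mul0r !addr0 mulr0.
exists (E 1 1); apply: (scalar_of_two_slopes (sc_s sc n2 n3 n23)) => //; exact: eig.
Qed.

Hypothesis (hA1 : forall i : 'I_p, \rank (A i) = 1%N <-> (i < pb)%N).
Hypothesis (hB1 : forall j : 'I_q, \rank (B j) = 1%N <-> (j < qb)%N).

(** Without interlacing, a separating quadratic is realized by a matrix with
prescribed entries in the frame; the motion it defines satisfies all conditions
strictly off the pair [i1, j1], but its quartic form is not zero. *)
Lemma crossing_of_rigid : inf_rigid2 A B ->
  exists i2 i3 j2 j3, [/\ [/\ i2 != i1, i3 != i1 & i2 != i3],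
    [/\ j2 != j1, j3 != j1 & j2 != j3] & crossing (s i2) (s i3) (r j2) (r j3) < 0].
Proof.
move=> rigid; apply: contrapT => none; have [_ rkM _] := hM.
pose S := [seq s i | i <- enum 'I_pb & i != i1].
pose T := [seq r j | j <- enum 'I_qb & j != j1].
have inS i : i != i1 -> s i \in S by move=> ni; rewrite map_f // mem_filter ni mem_enum.
have inT j : j != j1 -> r j \in T by move=> nj; rewrite map_f // mem_filter nj mem_enum.
have disj : {in S & T, forall x z, x != z}.
  move=> _ _ /mapP[i + ->] /mapP[j + ->]; rewrite !mem_filter => /andP[ni _] /andP[nj _].
  exact: (sc_sr sc).
have nocr : {in S & S, forall x x', {in T & T, forall z z', 0 <= crossing x x' z z'}}.
  move=> _ _ /mapP[i2 + ->] /mapP[i3 + ->] _ _ /mapP[j2 + ->] /mapP[j3 + ->].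
  rewrite !mem_filter => /andP[n2 _] /andP[n3 _] /andP[m2 _] /andP[m3 _].
  have [->|n23] := eqVneq i2 i3.
    by rewrite /crossing [X in _ * X]mulrC -expr2 sqr_ge0.
  have [->|m23] := eqVneq j2 j3; first by rewrite /crossing -expr2 sqr_ge0.
  by rewrite leNgt; apply/negP => cr; apply: none; exists i2, i3, j2, j3; split.
have [c0 [c1 [c2 [pos neg [x fx]]]]] := quad_separation disj nocr.
(* The entries are read off [quartic_quad]. *)
pose E : 'M[R]_3 := \matrix_(i, j)
  [:: 0; [:: c0; c2; 0]`_j; [:: c1 / Num.sqrt 2; 0; 0]`_j]`_i.
pose D := (frame_rot e)^T *m E *m frame_rot e.
have DE : in_frame e D = E by exact: in_frameK.
have slopeE z w : quartic D (z *: frame e w 1) = z ^+ 4 * quad c0 c1 c2 w.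
  rewrite quartic_slope DE !mxE //=; congr (_ * quad _ _ _ _); try ring.
  by rewrite subr0 mulrC divfK // sqrt2_neq0.
have scE (X : 'M[R]_2) : X = 0 -> svec X = 0.
  by move=> ->; rewrite -(scale0r (0 : 'M_2)) svecZ scale0r.
have [pA pB _] := hAB.
have [dA [dB [mot inf]]] :
    exists dA dB, motion_given_by D A B dA dB /\ inf_motion2 A B dA dB.
  apply: (motion_of_conditions hAB) => [i|j].
    have [ipb|/negP nipb] := boolP (i < pb)%N; last first.
      have [|A0|] := rank_neq1_psd (pA i); [by move/hA1| |by move=> ?; exact: Or31].
      by apply: Or32; exists 0; rewrite scE // mul0mx scaler0.
    have iE : i = widen_ord hpb (Ordinal ipb) by apply: val_inj.
    rewrite iE ha; have [->|ni] := eqVneq (Ordinal ipb) i1; last first.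
      apply: Or33; eexists; first by [].
      by rewrite (sc_a sc) // slopeE mulr_gt0 ?pow4_gt0 ?(sc_y sc) ?pos ?inS.
    apply: Or32; exists 0; rewrite -/(svec_outer _) (sc_a1 sc) svec_outerZ svec_outer_frame scale0r.
    rewrite /D -scalemxAl !mulmxA -[_ *m frame_rot e *m (frame_rot e)^T]mulmxA
      frame_rot_orth // mulmx1.
    have -> : svec_sq 1 0 *m E = 0.
      by apply/rowP => l; rewrite mxE sum_ord3 !mxE /=; ring.
    by rewrite mul0mx scaler0.
  have [jqb|/negP njqb] := boolP (j < qb)%N; last first.
    have [|B0|] := rank_neq1_psd (pB j); [by move/hB1| |by move=> ?; exact: Or31].
    by apply: Or32; exists 0; rewrite scE // trmx0 mulmx0 scaler0.
  have jE : j = widen_ord hqb (Ordinal jqb) by apply: val_inj.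
  rewrite jE hb; have [->|nj] := eqVneq (Ordinal jqb) j1; last first.
    apply: Or33; eexists; first by [].
    by rewrite perp_bE // slopeE pmulr_rlt0 ?pow4_gt0 ?(sc_u sc) ?neg ?inT.
  apply: Or32; exists c2; rewrite -/(svec_outer _) (sc_b1 sc) svec_outerZ svec_outer_frame.
  rewrite linearZ /= trmx_mul -scalemxAr scalerA [c2 * _]mulrC.
  rewrite -[RHS]scalerA; congr (_ *: _).
  rewrite /D -!mulmxA [frame_rot e *m (_ *m _)]mulmxA frame_rot_orth // mul1mx scalemxAr.
  congr (_ *m _); apply/colP => l; rewrite mxE sum_ord3 !mxE /=.
  by elim/ord3P: l; rewrite /=; ring.
have [D' mot' triv] := rigid dA dB inf.
have DD := motion_matrix_unique hAB rkM mot mot'; rewrite -{}DD in triv.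
have an : a i1 != 0.
  by rewrite (sc_a1 sc) frame_neq0 ?(sc_k sc) // expr0n addr0 expr1n oner_eq0.
have bn : b j1 != 0.
  by rewrite (sc_b1 sc) frame_neq0 ?(sc_m sc) // expr0n add0r expr1n oner_eq0.
have ab0 : dotv (a i1) (b j1) = 0.
  by rewrite (sc_a1 sc) (sc_b1 sc) dotvZ dot_frame //; ring.
have v0 : 1 *: frame e x 1 != 0.
  by rewrite frame_neq0 ?oner_eq0 // expr1n sq1_neq0.
have := trivial_quartic_eq0 hM hAB (ha i1) (hb j1) an bn ab0 triv v0.
by rewrite slopeE expr1n mul1r => /eqP; rewrite (negbTE fx).
Qed.

End Rigidity.

Theorem theorem5 (R : realType) (p q : nat) (M : 'M[R]_(p, q))
    (A : 'I_p -> 'M[R]_2) (B : 'I_q -> 'M[R]_2)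
    (hM : in_M32 M) (hAB : psd_factorization M A B)
    (pb qb : nat) (hpb : (pb <= p)%N) (hqb : (qb <= q)%N)
    (hpb1 : (1 <= pb)%N) (hqb1 : (1 <= qb)%N)
    (hA1 : forall i : 'I_p, \rank (A i) = 1%N <-> (i < pb)%N)
    (hB1 : forall j : 'I_q, \rank (B j) = 1%N <-> (j < qb)%N)
    (a : 'I_pb -> 'cV[R]_2) (b : 'I_qb -> 'cV[R]_2)
    (ha : forall i : 'I_pb, A (widen_ord hpb i) = a i *m (a i)^T)
    (hb : forall j : 'I_qb, B (widen_ord hqb j) = b j *m (b j)^T)
    (i1 : 'I_pb) (j1 : 'I_qb)
    (h11 : dotv (a i1) (b j1) = 0)
    (hdeta : forall i j : 'I_pb, i <> j -> det2 (a i) (a j) <> 0)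
    (hdetb : forall i j : 'I_qb, i <> j -> det2 (b i) (b j) <> 0)
    (hdot : forall (i : 'I_pb) (j : 'I_qb),
        (i, j) <> (i1, j1) -> dotv (a i) (b j) <> 0) :
  inf_rigid2 A B <->
  exists (i2 i3 : 'I_pb) (j2 j3 : 'I_qb),
    [/\ uniq [:: i1; i2; i3] /\ uniq [:: j1; j2; j3],
        0 < - ((det2 (b j1) (b j3) * det2 (b j2) (b j3)
                * dotv (a i1) (b j3) * dotv (a i3) (b j3))
               / (det2 (a i1) (a i2) * det2 (a i2) (a i3)
                * dotv (a i2) (b j1) * dotv (a i2) (b j2))),
        0 < (det2 (b j1) (b j3) * det2 (b j2) (b j3)
                * dotv (a i1) (b j3) * dotv (a i2) (b j3))
               / (det2 (a i1) (a i3) * det2 (a i2) (a i3)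
                * dotv (a i3) (b j1) * dotv (a i3) (b j2))
      & 0 < - ((det2 (b j1) (b j3)
                * dotv (a i1) (b j3) * dotv (a i2) (b j3) * dotv (a i3) (b j3))
               / (det2 (b j1) (b j2)
                * dotv (a i1) (b j2) * dotv (a i2) (b j2)
                * dotv (a i3) (b j2)))].
Proof.
have a0 : a i1 != 0.
  apply/eqP => z; have := (hA1 (widen_ord hpb i1)).2 (ltn_ord i1).
  by rewrite ha z mul0mx mxrank0.
have b0 : b j1 != 0.
  apply/eqP => z; have := (hB1 (widen_ord hqb j1)).2 (ltn_ord j1).
  by rewrite hb z mul0mx mxrank0.
have [e [k [m [y [s [u [r sc]]]]]]] :=
  slope_coordinates_exist a0 b0 h11 hdeta hdetb hdot.
split=> [rigid|[i2 [i3 [j2 [j3 [[ui uj] c1 c2 c3]]]]]].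
  have [i2 [i3 [j2 [j3 [[n2 n3 n23] [m2 m3 m23] cr]]]]] :=
    crossing_of_rigid hM hAB ha hb sc hA1 hB1 rigid.
  have [c1 c2 c3] := (conditions_crossing sc n2 n3 n23 m2 m3 m23).2 cr.
  exists i2, i3, j2, j3; split=> //.
  by rewrite /= !inE !negb_or !(eq_sym i1) !(eq_sym j1) n2 n3 n23 m2 m3 m23.
move: ui uj; rewrite /= !inE !negb_or !(eq_sym i1) !(eq_sym j1) !andbT.
move=> /andP[/andP[n2 n3] n23] /andP[/andP[m2 m3] m23].
have cr := (conditions_crossing sc n2 n3 n23 m2 m3 m23).1 (And3 c1 c2 c3).
exact: (rigid_of_crossing hM hAB ha hb sc n2 n3 m2 m3 n23 cr).
Qed.
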